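(* Let $\mathcal{C}$ be a stable $\infty$-category with zero object $0$. Let $\mathrm{K}_0(\mathcal{C})$ be the Grothendieck heap of $\mathcal{C}$ (viewing $\mathcal{C}$ as an unpointed stable $\infty$-category), and let $\mathrm{K}_0(\mathcal{C})_c$ be the classical Grothendieck group of $\mathcal{C}$. Then the retract $(\mathrm{K}_0(\mathcal{C}),+_{\overline{0}})$ of the Grothendieck heap along $\overline{0}$, i.e. the group with the operation $\overline{X}+_{\overline{0}}\overline{Y}=[\overline{X},\overline{0},\overline{Y}]$, recovers the classical Grothendieck group: the assignment $\overline{X}\mapsto\overline{X}_c$ on generators ($X$ an object of $\mathcal{C}$) induces a well-defined isomorphism of groups $$(\mathrm{K}_0(\mathcal{C}),+_{\overline{0}})\;\cong\;\mathrm{K}_0(\mathcal{C})_c .$$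
   Context: **Heaps.** A heap is a set $H$ with a ternary operation $(x,y,z)\mapsto[x,y,z]$ such that $[x,x,y]=y=[y,x,x]$ and $[x,y,[x',y',z']]=[[x,y,x'],y',z']$. It is abelian if $[x,y,z]=[z,y,x]$ for all $x,y,z$. For $e\in H$, the retract of $H$ along $e$ is the group $(H,+_e)$ with underlying set $H$ and operation $x+_e y:=[x,e,y]$. An abelian heap given by generators and relations is the quotient of the free abelian heap on the generators by the congruence generated by the relations. **Unpointed stable and stable $\infty$-categories.** An unpointed stable $\infty$-category is an $\infty$-category $\mathcal{C}$ that admits finite limits and colimits and in which a square $$\begin{array}{ccc} Y&\to& Y'\\ \downarrow&&\downarrow\\ X&\to& X'\end{array}$$ is a pushout if and only if it is a pullback. A square that is both a pushout and a pullback is called bicartesian. A stable $\infty$-category is an $\infty$-category satisfying these conditions that is moreover pointed, i.e. has a zero object $0$. (Equivalently: it is pointed, every morphism admits a kernel and a cokernel, and a triangle is exact if and only if it is coexact.) **Grothendieck heap.** For an unpointed stable $\infty$-category $\mathcal{C}$, $\mathrm{K}_0(\mathcal{C})$ is the abelian heap generated by the equivalence classes $\overline{X}$ of objects of $\mathcal{C}$, subject to the relations $[\overline{X},\overline{Y},\overline{Z}]=\overline{X\sqcup_Y Z}$ for every bicartesian square with initial vertex $Y$, middle vertices $X$ and $Z$, and terminal vertex $X\sqcup_Y Z$. **Classical Grothendieck group.** In a stable $\infty$-category an exact triangle $X\to Y\to Z$ is a pushout square $$\begin{array}{ccc} X&\to& Y\\ \downarrow&&\downarrow\\ 0&\to&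 Z.\end{array}$$ The classical Grothendieck group $\mathrm{K}_0(\mathcal{C})_c$ is the abelian group generated by the equivalence classes $\overline{X}_c$ of objects, subject to the relations $\overline{X}_c+\overline{Z}_c=\overline{Y}_c$ for every exact triangle $X\to Y\to Z$. *)

(* Defs.v *)
From HB Require Import structures.
From mathcomp Require Import all_boot all_order all_algebra.
From mathcomp Require Import generic_quotient ring_quotient freeg.
From mathcomp Require Import boolp classical_sets cardinality.

Set Implicit Arguments.
Unset Strict Implicit.
Unset Printing Implicit Defensive.

Import Order.TTheory GRing.Theory.

Local Open Scope classical_set_scope.
Local Open Scope quotient_scope.

(** The morphisms from [m] to [n] in the simplex category. *)
Notation mono m n := {omorphism 'I_m.+1 -> 'I_n.+1}.

Definition Mono m n (f : 'I_m.+1 -> 'I_n.+1)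
    (fP : {homo f : i j / (i <= j)%N}) : mono m n :=
  HB.pack_for (mono m n) f (Order.isOrderMorphism.Build _ _ _ _ f fP).

Lemma mono_le m n (f : mono m n) (i j : 'I_m.+1) : (i <= j)%N -> (f i <= f j)%N.
Proof. exact: (omorph_le f). Qed.

Lemma mono_eq m n (f g : mono m n) : f =1 g -> f = g.
Proof.
case: f => f [[fP]]; case: g => g [[gP]] /= /funext fg.
by case: _ / fg gP => gP; rewrite (Prop_irrelevance fP gP).
Qed.

Definition mono1 n : mono n n := [the mono n n of idfun].

Definition monoM l m n (f : mono m n) (g : mono l m) : mono l n :=
  [the mono l n of f \o g].

Lemma monoE m n (f : 'I_m.+1 -> 'I_n.+1) fP : @Mono m n f fP =1 f.
Proof. by []. Qed.

Lemma mono1E n : mono1 n =1 id. Proof. by []. Qed.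

Lemma monoME l m n (f : mono m n) (g : mono l m) : monoM f g =1 f \o g.
Proof. by []. Qed.

Record sset := SSet {
  simplex :> nat -> Type;
  act : forall m n, simplex n -> mono m n -> simplex m;
  act1 : forall n (x : simplex n), act x (mono1 n) = x;
  actM : forall l m n (x : simplex n) (f : mono m n) (g : mono l m),
    act (act x f) g = act x (monoM f g) }.
Arguments act {s m n}.

Record smap (K L : sset) := SMap {
  smap_fun :> forall n, K n -> L n;
  smap_act : forall m n (x : K n) (f : mono m n),
    smap_fun (act x f) = act (smap_fun x) f }.
Arguments smap_fun {K L} s {n}.

Lemma smap_comp_act K L M (g : smap L M) (f : smap K L) m n (x : K n)
    (a : mono m n) :
  g m (f m (act x a)) = act (g n (f n x)) a.
Proof. by rewrite !smap_act. Qed.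

Definition smap_comp K L M (g : smap L M) (f : smap K L) : smap K M :=
  SMap (smap_comp_act g f).

Section Subcomplex.
Variables (K : sset) (P : forall n, set (K n)).
Hypothesis PP : forall m n (x : K n) (f : mono m n), P x -> P (act x f).

Let simp n := {x : K n | P x}.
Let sact m n (x : simp n) (f : mono m n) : simp m :=
  exist _ (act (sval x) f) (PP f (svalP x)).

Lemma subcomplex_act1 n (x : simp n) : sact x (mono1 n) = x.
Proof. by case: x => x xP; apply: eq_exist; apply: act1. Qed.

Lemma subcomplex_actM l m n (x : simp n) (f : mono m n) (g : mono l m) :
  sact (sact x f) g = sact x (monoM f g).
Proof. by case: x => x xP; apply: eq_exist; apply: actM. Qed.

Definition subcomplex : sset := SSet subcomplex_act1 subcomplex_actM.

Definition subcomplex_incl : smap subcomplex K :=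
  @SMap subcomplex K (fun n (x : simp n) => sval x) (fun _ _ _ _ => erefl).
End Subcomplex.

Section Simplex.
Variable n : nat.

Lemma Delta_act1 m (f : mono m n) : monoM f (mono1 m) = f.
Proof. exact: mono_eq. Qed.

Lemma Delta_actM k l m (f : mono m n) (g : mono l m) (h : mono k l) :
  monoM (monoM f g) h = monoM f (monoM g h).
Proof. exact: mono_eq. Qed.

Definition Delta : sset :=
  @SSet (fun m => mono m n) (fun _ _ f g => monoM f g) Delta_act1 Delta_actM.

Definition in_boundary m (f : Delta m) : Prop :=
  exists j : 'I_n.+1, forall k, f k != j.

Lemma in_boundary_act l m (f : Delta m) (g : mono l m) :
  in_boundary f -> in_boundary (act f g).
Proof. by case=> j fj; exists j => k; apply: fj. Qed.

Definition boundary : sset := subcomplex in_boundary_act.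

Variable i : 'I_n.+1.

Definition in_horn m (f : Delta m) : Prop :=
  exists2 j : 'I_n.+1, j != i & forall k, f k != j.

Lemma in_horn_act l m (f : Delta m) (g : mono l m) :
  in_horn f -> in_horn (act f g).
Proof. by case=> j ji fj; exists j => // k; apply: fj. Qed.

Definition horn : sset := subcomplex in_horn_act.
End Simplex.

Section Product.
Variables K L : sset.

Let simp n : Type := (K n * L n)%type.
Let pact m n (x : simp n) (f : mono m n) : simp m := (act x.1 f, act x.2 f).

Lemma sprod_act1 n (x : simp n) : pact x (mono1 n) = x.
Proof. by case: x => x y; rewrite /pact !act1. Qed.

Lemma sprod_actM l m n (x : simp n) (f : mono m n) (g : mono l m) :
  pact (pact x f) g = pact x (monoM f g).
Proof. by case: x => x y; rewrite /pact /= !actM. Qed.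

Definition sprod : sset := SSet sprod_act1 sprod_actM.
End Product.

Section Reverse.
Variables m n : nat.

Lemma mono_rev_homo (f : mono m n) :
  {homo (fun i => rev_ord (f (rev_ord i))) : i j / (i <= j)%N}.
Proof.
by move=> i j ij; rewrite /= leq_sub2l// ltnS mono_le//= leq_sub2l.
Qed.

Definition mono_rev (f : mono m n) : mono m n := Mono (mono_rev_homo f).
End Reverse.

Lemma mono_rev1 n : mono_rev (mono1 n) = mono1 n.
Proof. by apply: mono_eq => i; rewrite /= rev_ordK. Qed.

Lemma mono_revM l m n (f : mono m n) (g : mono l m) :
  mono_rev (monoM f g) = monoM (mono_rev f) (mono_rev g).
Proof. by apply: mono_eq => i; rewrite /= rev_ordK. Qed.

Section Opposite.
Variable K : sset.

Let oact m n (x : K n) (f : mono m n) : K m := act x (mono_rev f).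

Lemma op_act1 n (x : K n) : oact x (mono1 n) = x.
Proof. by rewrite /oact mono_rev1 act1. Qed.

Lemma op_actM l m n (x : K n) (f : mono m n) (g : mono l m) :
  oact (oact x f) g = oact x (monoM f g).
Proof. by rewrite /oact actM mono_revM. Qed.

Definition op : sset := SSet op_act1 op_actM.
End Opposite.

Definition op_map (K L : sset) (p : smap K L) : smap (op K) (op L) :=
  @SMap (op K) (op L) (fun n => p n) (fun _ _ x f => smap_act p x (mono_rev f)).

Definition degenerate (K : sset) n (x : K n) : Prop :=
  exists m (f : mono n m) (y : K m), (m < n)%N /\ x = act y f.

Definition finite_sset (K : sset) : Prop :=
  finite_set [set s : {n & K n} | ~ degenerate (tagged s)].

Definition quasicategory (C : sset) : Prop :=
  forall n (i : 'I_n.+1), (0 < i < n)%N -> forall h : smap (horn i) C,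
  exists x : C n, forall m (f : horn i m), h m f = act x (sval f).

Lemma mono_face_homo n (i : 'I_n.+2) :
  {homo (fun j : 'I_n.+1 => fintype.lift i j) : j k / (j <= k)%N}.
Proof. by move=> j k; rewrite /= leq_bump2. Qed.

Definition mono_face n (i : 'I_n.+2) : mono n n.+1 := Mono (@mono_face_homo n i).

Definition face n (C : sset) (i : 'I_n.+2) (x : C n.+1) : C n :=
  act x (mono_face i).

Definition mono_cst m n (i : 'I_n.+1) : mono m n :=
  @Mono m n (fun=> i) (fun _ _ _ => leqnn i).

Definition id_edge (C : sset) (X : C 0) : C 1 := act X (mono_cst 1 ord0).

(** [equivalent X Y]: there are edges [f : X -> Y] and [g : Y -> X] with
    2-simplices witnessing [g f = id] and [f g = id] in the homotopy category;
    the endpoints of [f] and [g] are forced by the simplicial identities. *)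
Definition equivalent (C : sset) (X Y : C 0) : Prop :=
  exists (f g : C 1) (s t : C 2),
    [/\ face (inord 2) s = f, face (inord 0) s = g & face (inord 1) s = id_edge X] /\
    [/\ face (inord 2) t = g, face (inord 0) t = f & face (inord 1) t = id_edge Y].

(** Joyal's definition: a vertex is initial if every sphere of positive dimension
    whose vertex 0 is that vertex can be filled. *)
Definition initial (C : sset) (X : C 0) : Prop :=
  forall n, (0 < n)%N -> forall b : smap (boundary n) C,
  (forall v : boundary n 0, sval v ord0 = ord0 -> b 0 v = X) ->
  exists x : C n, forall m (f : boundary n m), b m f = act x (sval f).

Definition terminal (C : sset) (X : C 0) : Prop := initial (X : op C 0).

Definition zero_object (C : sset) (X : C 0) : Prop := initial X /\ terminal X.

(** The ordinal sum of [k] and [n] is [k + n + 1]; its underlying set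
    ['I_(k + n.+1).+1] is convertible to ['I_(k.+1 + n.+1)]. *)
Section OrdinalSum.
Variables k n : nat.

Lemma mono_inl_homo :
  {homo (@lshift k.+1 n.+1 : 'I_k.+1 -> 'I_(k + n.+1).+1) : i j / (i <= j)%N}.
Proof. by []. Qed.

Definition mono_inl : mono k (k + n.+1) := Mono mono_inl_homo.

Lemma mono_inr_homo :
  {homo (@rshift k.+1 n.+1 : 'I_n.+1 -> 'I_(k + n.+1).+1) : i j / (i <= j)%N}.
Proof. by move=> i j; rewrite /= leq_add2l. Qed.

Definition mono_inr : mono n (k + n.+1) := Mono mono_inr_homo.

Variables (k' n' : nat) (f : mono k' k) (g : mono n' n).

Definition ord_sum (i : 'I_(k' + n'.+1).+1) : 'I_(k + n.+1).+1 :=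
  match split (i : 'I_(k'.+1 + n'.+1)) with
  | inl a => mono_inl (f a)
  | inr b => mono_inr (g b)
  end.

Lemma ord_sum_homo : {homo ord_sum : i j / (i <= j)%N}.
Proof.
move=> i j ij; rewrite /ord_sum.
case: (split_ordP (i : 'I_(k'.+1 + n'.+1))) ij => a ->;
  case: (split_ordP (j : 'I_(k'.+1 + n'.+1))) => b -> /=.
- exact: mono_le.
- by move=> _; rewrite (leq_trans (ltnW (ltn_ord _)))// leq_addr.
- by move=> /(leq_trans (leq_addr _ _)); rewrite leqNgt ltn_ord.
- by rewrite !leq_add2l; apply: mono_le.
Qed.

Definition mono_sum : mono (k' + n'.+1) (k + n.+1) := Mono ord_sum_homo.

Lemma mono_sum_inl a :
  mono_sum (lshift n'.+1 a : 'I_(k'.+1 + n'.+1)) = mono_inl (f a).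
Proof. by rewrite /= /ord_sum (unsplitK (inl a)). Qed.

Lemma mono_sum_inr b :
  mono_sum (rshift k'.+1 b : 'I_(k'.+1 + n'.+1)) = mono_inr (g b).
Proof. by rewrite /= /ord_sum (unsplitK (inr b)). Qed.

End OrdinalSum.

Lemma mono_sum1 k n : mono_sum (mono1 k) (mono1 n) = mono1 (k + n.+1).
Proof.
apply: mono_eq => i; case: (split_ordP (i : 'I_(k.+1 + n.+1))) => a ->.
  exact: mono_sum_inl.
exact: mono_sum_inr.
Qed.

Lemma mono_sumM k k' k'' n n' n'' (f : mono k' k) (f' : mono k'' k')
    (g : mono n' n) (g' : mono n'' n') :
  monoM (mono_sum f g) (mono_sum f' g') =
  mono_sum (monoM f f') (monoM g g').
Proof.
apply: mono_eq => i; rewrite monoME /=.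
case: (split_ordP (i : 'I_(k''.+1 + n''.+1))) => a ->; rewrite /ord_sum.
  by rewrite !(unsplitK (inl _)).
by rewrite !(unsplitK (inr _)).
Qed.

Lemma mono_sum_comp_inl k k' n n' (f : mono k' k) (g : mono n' n) :
  monoM (mono_sum f g) (mono_inl k' n') = monoM (mono_inl k n) f.
Proof. by apply: mono_eq => i; apply: mono_sum_inl. Qed.

Lemma mono_sum_comp_inr k k' n n' (f : mono k' k) (g : mono n' n) :
  monoM (mono_sum f g) (mono_inr k' n') = monoM (mono_inr k n) g.
Proof. by apply: mono_eq => i; apply: mono_sum_inr. Qed.

(** The coslice [C_{p/}] of [p : K -> C]: its [n]-simplices are the maps from the
    join [K * Delta n] to [C] restricting to [p] on [K]. Such a map is given by the
    image [apex] of the top simplex of [Delta n] and, naturally in the simplex [x]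
    of [K], by the image [cone x] of the join of [x] with that top simplex. *)
Section Coslice.
Variables (K C : sset) (p : smap K C).

Record coslice_simplex n := CosliceSimplex {
  apex : C n;
  cone : forall k, K k -> C (k + n.+1);
  cone_inl : forall k (x : K k), act (cone x) (mono_inl k n) = p k x;
  cone_inr : forall k (x : K k), act (cone x) (mono_inr k n) = apex;
  cone_act : forall k' k (x : K k) (f : mono k' k),
    cone (act x f) = act (cone x) (mono_sum f (mono1 n)) }.

Lemma coslice_simplex_eq n (c d : coslice_simplex n) :
  apex c = apex d -> (forall k (x : K k), cone c x = cone d x) -> c = d.
Proof.
case: c d => [a c c1 c2 c3] [b d d1 d2 d3] /= ab cd.
have {}cd : c = d by do 2![apply: functional_extensionality_dep => ?]; apply: cd.
case: _ / ab d2 => d2; case: _ / cd d1 d2 d3 => d1 d2 d3.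
congr CosliceSimplex; exact: Prop_irrelevance.
Qed.

Section Act.
Variables (m n : nat) (c : coslice_simplex n) (g : mono m n).

Let acone k (x : K k) : C (k + m.+1) := act (cone c x) (mono_sum (mono1 k) g).

Lemma coslice_act_inl k (x : K k) : act (acone x) (mono_inl k m) = p k x.
Proof. by rewrite actM mono_sum_comp_inl -actM cone_inl act1. Qed.

Lemma coslice_act_inr k (x : K k) :
  act (acone x) (mono_inr k m) = act (apex c) g.
Proof. by rewrite actM mono_sum_comp_inr -actM cone_inr. Qed.

Lemma coslice_act_act k' k (x : K k) (f : mono k' k) :
  acone (act x f) = act (acone x) (mono_sum f (mono1 m)).
Proof.
rewrite /acone cone_act !actM !mono_sumM; congr (act _ (mono_sum _ _));
  exact: mono_eq.
Qed.

Definition coslice_act : coslice_simplex m :=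
  CosliceSimplex coslice_act_inl coslice_act_inr coslice_act_act.
End Act.

Lemma coslice_act1 n (c : coslice_simplex n) : coslice_act c (mono1 n) = c.
Proof. by apply: coslice_simplex_eq => [|k x] /=; rewrite ?mono_sum1 act1. Qed.

Lemma coslice_actM l m n (c : coslice_simplex n) (f : mono m n) (g : mono l m) :
  coslice_act (coslice_act c f) g = coslice_act c (monoM f g).
Proof.
apply: coslice_simplex_eq => [|k x] /=; rewrite actM// mono_sumM.
by congr (act _ (mono_sum _ _)); apply: mono_eq.
Qed.

Definition coslice : sset := SSet coslice_act1 coslice_actM.
End Coslice.

Definition colimit_cone (K C : sset) (p : smap K C) (c : coslice p 0) : Prop :=
  initial c.

Definition has_colimit (K C : sset) (p : smap K C) : Prop :=
  exists c : coslice p 0, colimit_cone c.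

(** A limit in [C] is a colimit in [op C] of the opposite diagram. *)
Definition has_limit (K C : sset) (p : smap K C) : Prop :=
  has_colimit (op_map p).

Definition finite_colimits (C : sset) : Prop :=
  forall K : sset, finite_sset K -> forall p : smap K C, has_colimit p.

Definition finite_limits (C : sset) : Prop :=
  forall K : sset, finite_sset K -> forall p : smap K C, has_limit p.

Definition Square : sset := sprod (Delta 1) (Delta 1).

Definition vertex (a b : 'I_2) : Square 0 := (mono_cst 0 a, mono_cst 0 b).

(** The simplices of the square avoiding the vertex (1, 1): this is the
    horn consisting of the edges from (0, 0) to (1, 0) and to (0, 1). *)
Definition in_span n (x : Square n) : Prop :=
  forall i, ~~ ((x.1 i == ord_max) && (x.2 i == ord_max)).

Lemma in_span_act m n (x : Square n) (f : mono m n) :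
  in_span x -> in_span (act x f).
Proof. by move=> xP i; apply: xP. Qed.

Definition Span : sset := subcomplex in_span_act.

Definition span_incl : smap Span Square := subcomplex_incl in_span_act.

Section Snoc.
Variables (k : nat) (f : mono k 1).

Definition snoc_max_fun (i : 'I_(k + 1).+1) : 'I_2 :=
  if split (i : 'I_(k.+1 + 1)) is inl a then f a else ord_max.

Lemma snoc_max_homo : {homo snoc_max_fun : i j / (i <= j)%N}.
Proof.
move=> i j ij; rewrite /snoc_max_fun.
case: (split_ordP (j : 'I_(k.+1 + 1))) ij => b ->; last by rewrite leq_ord.
case: (split_ordP (i : 'I_(k.+1 + 1))) => a -> /=; first exact: mono_le.
by move=> /(leq_trans (leq_addr _ _)); rewrite leqNgt ltn_ord.
Qed.

Definition snoc_max : mono (k + 1) 1 := Mono snoc_max_homo.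

Lemma snoc_max_inl a : snoc_max (lshift 1 a : 'I_(k.+1 + 1)) = f a.
Proof. by rewrite /= /snoc_max_fun (unsplitK (inl a)). Qed.

Lemma snoc_max_inr b : snoc_max (rshift k.+1 b : 'I_(k.+1 + 1)) = ord_max.
Proof. by rewrite /= /snoc_max_fun (unsplitK (inr b)). Qed.
End Snoc.

Lemma snoc_max_comp_inl k (f : mono k 1) :
  monoM (snoc_max f) (mono_inl k 0) = f.
Proof. by apply: mono_eq => i; apply: snoc_max_inl. Qed.

Lemma snoc_max_comp_inr k (f : mono k 1) :
  monoM (snoc_max f) (mono_inr k 0) = mono_cst 0 ord_max.
Proof. by apply: mono_eq => i; apply: snoc_max_inr. Qed.

Lemma snoc_max_act k' k (f : mono k 1) (g : mono k' k) :
  snoc_max (monoM f g) = monoM (snoc_max f) (mono_sum g (mono1 0)).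
Proof.
apply: mono_eq => i; rewrite monoME /=.
case: (split_ordP (i : 'I_(k'.+1 + 1))) => a ->.
  by rewrite /snoc_max_fun /ord_sum !(unsplitK (inl _)).
by rewrite /snoc_max_fun /ord_sum !(unsplitK (inr _)).
Qed.

Section SquareCone.
Variables (C : sset) (q : smap Square C).

Definition span_of : smap Span C := smap_comp q span_incl.

Let qcone k (x : Span k) : C (k + 1) :=
  q (k + 1) (snoc_max (sval x).1, snoc_max (sval x).2).

Lemma square_cone_inl k (x : Span k) :
  act (qcone x) (mono_inl k 0) = span_of k x.
Proof.
by rewrite -smap_act /= !snoc_max_comp_inl; case: x => [[]].
Qed.

Lemma square_cone_inr k (x : Span k) :
  act (qcone x) (mono_inr k 0) = q 0 (vertex ord_max ord_max).
Proof. by rewrite -smap_act /= !snoc_max_comp_inr. Qed.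

Lemma square_cone_act k' k (x : Span k) (f : mono k' k) :
  qcone (act x f) = act (qcone x) (mono_sum f (mono1 0)).
Proof. by rewrite -smap_act /qcone /= !snoc_max_act. Qed.

Definition square_cone : coslice span_of 0 :=
  CosliceSimplex square_cone_inl square_cone_inr square_cone_act.
End SquareCone.

Definition pushout (C : sset) (q : smap Square C) : Prop :=
  colimit_cone (square_cone q).

(** The square of [op C] obtained from [q] by reversing both coordinates; it
    exchanges (0, 0) with (1, 1), and (1, 0) with (0, 1). *)
Section OppositeSquare.
Variables (C : sset) (q : smap Square C).

Let oq n (x : Square n) : op C n := q n (mono_rev x.1, mono_rev x.2).

Lemma op_square_act m n (x : Square n) (f : mono m n) :
  oq (act x f) = act (oq x) f.
Proof. by rewrite /oq /= !mono_revM -smap_act. Qed.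

Definition op_square : smap Square (op C) := SMap op_square_act.
End OppositeSquare.

Definition pullback (C : sset) (q : smap Square C) : Prop :=
  pushout (op_square q).

Definition bicartesian (C : sset) (q : smap Square C) : Prop :=
  pushout q /\ pullback q.

Definition corner (C : sset) (q : smap Square C) (a b : 'I_2) : C 0 :=
  q 0 (vertex a b).

Definition unpointed_stable (C : sset) : Prop :=
  [/\ quasicategory C, finite_limits C, finite_colimits C &
      forall q : smap Square C, pushout q <-> pullback q].

Definition stable (C : sset) : Prop :=
  unpointed_stable C /\ exists X : C 0, zero_object X.

HB.mixin Record isHeap T := {
  hop : T -> T -> T -> T;
  hop_idl : forall x y, hop x x y = y;
  hop_idr : forall x y, hop y x x = y;
  hop_assoc : forall x y x' y' z', hop x y (hop x' y' z') = hop (hop x y x') y' z' }.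

#[short(type="heapType")]
HB.structure Definition Heap := {T of isHeap T & Choice T}.

HB.mixin Record isAbelianHeap T of Heap T := {
  hopC : forall x y z : T, hop x y z = hop z y x }.

#[short(type="abHeapType")]
HB.structure Definition AbelianHeap := {T of isAbelianHeap T & Heap T}.

Definition retract (H : abHeapType) (e : H) : Type := H.

Section Retract.
Variables (H : abHeapType) (e : H).
Local Notation retract := (retract e).

HB.instance Definition _ := Choice.on retract.

Let radd (x y : retract) : retract := hop (x : H) e y.
Let ropp (x : retract) : retract := hop e (x : H) e.

Lemma retract_addA : associative radd.
Proof. by move=> x y z; apply: hop_assoc. Qed.

Lemma retract_addC : commutative radd.
Proof. by move=> x y; apply: hopC. Qed.

Lemma retract_add0 : left_id (e : retract) radd.
Proof. by move=> x; apply: hop_idl. Qed.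

Lemma retract_addN : left_inverse (e : retract) ropp radd.
Proof. by move=> x; rewrite /radd /ropp -hop_assoc hop_idl hop_idr. Qed.

HB.instance Definition _ := GRing.isZmodule.Build retract
  retract_addA retract_addC retract_add0 retract_addN.

Lemma retractE (x y : retract) : (x + y)%R = hop (x : H) e y.
Proof. by []. Qed.
End Retract.

(** The free abelian heap on [X]: words in the ternary operation modulo the
    axioms of abelian heaps. *)
Inductive heap_word (X : Type) : Type :=
| hw_gen of X
| hw_op of heap_word X & heap_word X & heap_word X.

HB.instance Definition _ (X : Type) := gen_eqMixin (heap_word X).
HB.instance Definition _ (X : Type) := gen_choiceMixin (heap_word X).

Section FreeAbelianHeap.
Variable X : Type.
Local Notation W := (heap_word X).

Inductive heap_eq : W -> W -> Prop :=
| heap_eq_refl u : heap_eq u u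
| heap_eq_sym u v : heap_eq u v -> heap_eq v u
| heap_eq_trans u v w : heap_eq u v -> heap_eq v w -> heap_eq u w
| heap_eq_op u u' v v' w w' : heap_eq u u' -> heap_eq v v' -> heap_eq w w' ->
    heap_eq (hw_op u v w) (hw_op u' v' w')
| heap_eq_idl u v : heap_eq (hw_op u u v) v
| heap_eq_idr u v : heap_eq (hw_op v u u) v
| heap_eq_assoc u v u' v' w' :
    heap_eq (hw_op u v (hw_op u' v' w')) (hw_op (hw_op u v u') v' w')
| heap_eq_comm u v w : heap_eq (hw_op u v w) (hw_op w v u).

Let r (u v : W) : bool := `[< heap_eq u v >].

Lemma heap_eq_equiv : equiv_class_of r.
Proof.
split=> [u|u v|v u w].
- by apply/asboolP/heap_eq_refl.
- by apply/asboolP/asboolP; apply: heap_eq_sym.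
- by move=> /asboolP uv /asboolP vw; apply/asboolP/(heap_eq_trans uv).
Qed.

Canonical heap_eq_equivRel := EquivRelPack heap_eq_equiv.

Definition free_heap : Type := {eq_quot heap_eq_equivRel}.

HB.instance Definition _ := Choice.on free_heap.
HB.instance Definition _ := Quotient.on free_heap.

Definition heap_gen (x : X) : free_heap := \pi_free_heap (hw_gen x).

Lemma free_heap_eqP (u v : W) :
  \pi_free_heap u = \pi_free_heap v <-> heap_eq u v.
Proof.
split=> [/eqquotP/asboolP//|uv]; exact/eqquotP/asboolP.
Qed.

Let fop (a b c : free_heap) : free_heap :=
  \pi_free_heap (hw_op (repr a) (repr b) (repr c)).

Lemma free_heap_opE u v w :
  fop (\pi_free_heap u) (\pi_free_heap v) (\pi_free_heap w) =
  \pi_free_heap (hw_op u v w).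
Proof. by apply/free_heap_eqP/heap_eq_op; apply/free_heap_eqP; rewrite reprK. Qed.

Lemma free_heap_idl a b : fop a a b = b.
Proof.
elim/quotW: a => a; elim/quotW: b => b; rewrite !free_heap_opE.
exact/free_heap_eqP/heap_eq_idl.
Qed.

Lemma free_heap_idr a b : fop b a a = b.
Proof.
elim/quotW: a => a; elim/quotW: b => b; rewrite !free_heap_opE.
exact/free_heap_eqP/heap_eq_idr.
Qed.

Lemma free_heap_assoc a b a' b' c' :
  fop a b (fop a' b' c') = fop (fop a b a') b' c'.
Proof.
elim/quotW: a => a; elim/quotW: b => b; elim/quotW: a' => a'.
elim/quotW: b' => b'; elim/quotW: c' => c'.
rewrite (free_heap_opE a' b' c') (free_heap_opE a b a') !free_heap_opE.
exact/free_heap_eqP/heap_eq_assoc.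
Qed.

Lemma free_heap_comm a b c : fop a b c = fop c b a.
Proof.
elim/quotW: a => a; elim/quotW: b => b; elim/quotW: c => c.
rewrite !free_heap_opE; exact/free_heap_eqP/heap_eq_comm.
Qed.

HB.instance Definition _ :=
  isHeap.Build free_heap free_heap_idl free_heap_idr free_heap_assoc.
HB.instance Definition _ := isAbelianHeap.Build free_heap free_heap_comm.

Lemma free_heap_hopE u v w :
  hop (\pi_free_heap u) (\pi_free_heap v) (\pi_free_heap w) =
  \pi_free_heap (hw_op u v w).
Proof. exact: free_heap_opE. Qed.
End FreeAbelianHeap.

Section HeapQuotient.
Variables (H : abHeapType) (R : H -> H -> Prop).

Inductive heap_cong : H -> H -> Prop :=
| heap_cong_rel x y : R x y -> heap_cong x y
| heap_cong_refl x : heap_cong x x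
| heap_cong_sym x y : heap_cong x y -> heap_cong y x
| heap_cong_trans x y z : heap_cong x y -> heap_cong y z -> heap_cong x z
| heap_cong_op x x' y y' z z' :
    heap_cong x x' -> heap_cong y y' -> heap_cong z z' ->
    heap_cong (hop x y z) (hop x' y' z').

Let r (x y : H) : bool := `[< heap_cong x y >].

Lemma heap_cong_equiv : equiv_class_of r.
Proof.
split=> [x|x y|y x z].
- by apply/asboolP/heap_cong_refl.
- by apply/asboolP/asboolP; apply: heap_cong_sym.
- by move=> /asboolP xy /asboolP yz; apply/asboolP/(heap_cong_trans xy).
Qed.

Canonical heap_cong_equivRel := EquivRelPack heap_cong_equiv.

Definition heap_quot : Type := {eq_quot heap_cong_equivRel}.

HB.instance Definition _ := Choice.on heap_quot.
HB.instance Definition _ := Quotient.on heap_quot.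

Definition heap_proj (x : H) : heap_quot := \pi_heap_quot x.

Lemma heap_quot_eqP (x y : H) : heap_proj x = heap_proj y <-> heap_cong x y.
Proof.
split=> [/eqquotP/asboolP//|xy]; exact/eqquotP/asboolP.
Qed.

Let qop (a b c : heap_quot) : heap_quot :=
  heap_proj (hop (repr a) (repr b) (repr c)).

Lemma heap_quot_opE x y z :
  qop (heap_proj x) (heap_proj y) (heap_proj z) = heap_proj (hop x y z).
Proof.
by apply/heap_quot_eqP/heap_cong_op; apply/heap_quot_eqP; rewrite /heap_proj reprK.
Qed.

Lemma heap_projW (P : heap_quot -> Prop) :
  (forall x, P (heap_proj x)) -> forall a, P a.
Proof. by move=> Px; elim/quotW. Qed.

Lemma heap_quot_idl a b : qop a a b = b.
Proof.
by elim/heap_projW: a => x; elim/heap_projW: b => y; rewrite heap_quot_opE hop_idl.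
Qed.

Lemma heap_quot_idr a b : qop b a a = b.
Proof.
by elim/heap_projW: a => x; elim/heap_projW: b => y; rewrite heap_quot_opE hop_idr.
Qed.

Lemma heap_quot_assoc a b a' b' c' :
  qop a b (qop a' b' c') = qop (qop a b a') b' c'.
Proof.
elim/heap_projW: a => a; elim/heap_projW: b => b; elim/heap_projW: a' => a'.
elim/heap_projW: b' => b'; elim/heap_projW: c' => c'.
rewrite (heap_quot_opE a' b' c') (heap_quot_opE a b a') !heap_quot_opE.
by rewrite hop_assoc.
Qed.

Lemma heap_quot_comm a b c : qop a b c = qop c b a.
Proof.
elim/heap_projW: a => a; elim/heap_projW: b => b; elim/heap_projW: c => c.
by rewrite !heap_quot_opE hopC.
Qed.

HB.instance Definition _ :=
  isHeap.Build heap_quot heap_quot_idl heap_quot_idr heap_quot_assoc.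
HB.instance Definition _ := isAbelianHeap.Build heap_quot heap_quot_comm.

Lemma heap_projE x y z :
  hop (heap_proj x) (heap_proj y) (heap_proj z) = heap_proj (hop x y z).
Proof. exact: heap_quot_opE. Qed.
End HeapQuotient.

Section GeneratedSubgroup.
Local Open Scope ring_scope.
Variables (V : zmodType) (A : set V).

Definition subgroup_gen (x : V) : bool :=
  `[< forall S : {pred V}, zmod_closed S -> (forall a, A a -> a \in S) -> x \in S >].

Lemma subgroup_gen_closed : zmod_closed subgroup_gen.
Proof.
split=> [|x y /asboolP xA /asboolP yA]; apply/asboolP => S S_closed AS.
  exact: S_closed.1.
by apply: (S_closed.2); [apply: xA|apply: yA].
Qed.

HB.instance Definition _ :=
  GRing.isZmodClosed.Build V subgroup_gen subgroup_gen_closed.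

Definition subgroup_gen_zmodClosed : zmodClosed V :=
  GRing.ZmodClosed.clone V subgroup_gen _.

Definition zmod_quot : zmodType := Quotient.quot subgroup_gen_zmodClosed.

Definition zmod_proj (x : V) : zmod_quot :=
  \pi_(Quotient.quot subgroup_gen_zmodClosed) x.
End GeneratedSubgroup.

Section Grothendieck.
Variable C : sset.

(** In a quasi-category [equivalent] is an equivalence relation, and these are its
    classes. *)
Definition object_class : Type :=
  {A : set (C 0) | exists X, A = [set Y | equivalent X Y]}.

HB.instance Definition _ := gen_eqMixin object_class.
HB.instance Definition _ := gen_choiceMixin object_class.

Definition object_class_of (X : C 0) : object_class :=
  exist _ [set Y | equivalent X Y] (ex_intro _ X erefl).

Definition K0_rel (u v : free_heap object_class) : Prop :=
  exists2 q : smap Square C, bicartesian q &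
    u = hop (heap_gen (object_class_of (corner q ord_max ord0)))
            (heap_gen (object_class_of (corner q ord0 ord0)))
            (heap_gen (object_class_of (corner q ord0 ord_max))) /\
    v = heap_gen (object_class_of (corner q ord_max ord_max)).

Definition K0 : abHeapType := heap_quot K0_rel.

Definition K0_class (X : C 0) : K0 :=
  heap_proj K0_rel (heap_gen (object_class_of X)).

Definition exact_triangle (o X Y Z : C 0) : Prop :=
  exists2 q : smap Square C, pushout q &
    [/\ corner q ord0 ord0 = X, corner q ord_max ord0 = Y,
        corner q ord0 ord_max = o & corner q ord_max ord_max = Z].

Local Open Scope ring_scope.

Definition K0c_rel (o : C 0) : set {freeg object_class / int} :=
  [set u | exists X Y Z, exact_triangle o X Y Z /\
     u = << object_class_of X >> + << object_class_of Z >> - << object_class_of Y >>].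

Definition K0c (o : C 0) : zmodType := zmod_quot (K0c_rel o).

Definition K0c_class (o X : C 0) : K0c o :=
  zmod_proj (K0c_rel o) << object_class_of X >>.
End Grothendieck.

(* Main.v *)
(** Everything rests on one additivity statement: the classes in the classical
    group of the corners of a pushout square [Y -> X], [Y -> Z], [X -> W], [Z -> W]
    satisfy [X + Z = Y + W]. Indeed, pushing [Z -> W] out along [Z -> o] gives an
    exact triangle [Z -> W -> Q], and by the pasting law the composite square is the
    exact triangle [Y -> X -> Q]. Applied to the square of an exact triangle the
    statement also gives [o = 0]. Hence the generators of the heap map to the
    classical group; conversely, the square of an exact triangle [X -> Y -> Z] gives
    [Z = [Y, X, o]] in the heap, that is [Z = Y - X] in the retract.

    The pasting law is proved by lifting cones. A cone under a finite poset is a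
    partial map from a simplex, cones are extended along right anodyne inclusions of
    posets by filling inner horns, and along the inclusion of a span into its
    pushout square by the universal property of the latter. *)

From HB Require Import structures.
Require Import Defs.
From mathcomp Require Import all_boot all_order all_algebra.
From mathcomp Require Import generic_quotient ring_quotient freeg.
From mathcomp Require Import boolp.
From mathcomp Require classical_sets cardinality.

Set Implicit Arguments.
Unset Strict Implicit.
Unset Printing Implicit Defensive.

Import Order.TTheory GRing.Theory.

(** The obstacle is dependent typing: the simplices of a horn, a join or a coslice would live in
    subset types or in dimensions that vary with their pieces, and would be transported along every
    face map. Each diagram shape is therefore a finite poset numbered by a linear extension of its
    order. Its nerve is the subcomplex of one [Delta m] whose simplices have a chain as set of
    vertices; the join with [Delta n] is again a subcomplex of one simplex, and a cone, a sphere of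
    cones or a filler is a total function on simplices, natural on a prescribed family.

    Cones extend along right anodyne inclusions because a horn at a vertex other than the first
    becomes inner once it is joined with the vertices of the cone. The span of the second square
    reaches the whole rectangle by such horns alone. The span of the composite reaches everything
    but the corner 3 in this way, and the universal property of the first pushout supplies 3. So
    cones under either span amount to cones under the rectangle, and initiality passes between
    them. *)

Lemma monoA k l m n (f : mono m n) (g : mono l m) (h : mono k l) :
  monoM (monoM f g) h = monoM f (monoM g h).
Proof. exact: mono_eq. Qed.

Lemma monoMx l m n (f : mono m n) (g : mono l m) i : monoM f g i = f (g i).
Proof. by []. Qed.

Lemma monoM1 m n (f : mono m n) : monoM f (mono1 m) = f.
Proof. exact: mono_eq. Qed.

Lemma mono1M m n (f : mono m n) : monoM (mono1 n) f = f.
Proof. exact: mono_eq. Qed.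

(** * Vertex sets of the simplices of a simplex *)

Definition mono_im l N (f : mono l N) : {set 'I_N.+1} := [set f i | i in 'I_l.+1].

Lemma mono_imP l N (f : mono l N) j : reflect (exists i, f i = j) (j \in mono_im f).
Proof.
by apply: (iffP imsetP) => [[i _ ->]|[i <-]]; [exists i|exists i].
Qed.

Lemma mem_mono_im l N (f : mono l N) i : f i \in mono_im f.
Proof. exact: imset_f. Qed.

Lemma mono_imM k l N (f : mono l N) (g : mono k l) :
  mono_im (monoM f g) = f @: mono_im g.
Proof. by rewrite /mono_im -imset_comp. Qed.

Lemma mono_imMS k l N (f : mono l N) (g : mono k l) :
  mono_im (monoM f g) \subset mono_im f.
Proof. by apply/subsetP => _ /mono_imP[i <-]; apply: (mem_mono_im f). Qed.

Lemma mono_im_cst m n (j : 'I_n.+1) : mono_im (mono_cst m j) = [set j].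
Proof.
apply/setP => i; rewrite inE; apply/mono_imP/eqP => [[_ <-//]|->].
by exists ord0.
Qed.

Lemma mono_im_singleton m n (f : mono m n) j :
  mono_im f \subset [set j] -> f = mono_cst m j.
Proof.
move=> /subsetP fj; apply: mono_eq => i; apply/eqP.
by have := fj _ (mem_mono_im f i); rewrite inE.
Qed.

Lemma monoKL m n (s : mono m n) (r : mono n m) : monoM r s = mono1 m -> cancel s r.
Proof. by move=> rs x; have /(congr1 (fun f : mono m m => f x)) := rs. Qed.

Lemma mono_imK l m n (s : mono m n) (r : mono n m) (f : mono l n) :
  monoM r s = mono1 m -> mono_im f \subset mono_im s -> monoM s (monoM r f) = f.
Proof.
move=> /monoKL rs /subsetP fs; apply: mono_eq => i; rewrite /=.
by have /mono_imP[j <-] := fs _ (mem_mono_im f i); rewrite rs.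
Qed.

Definition down (T : finType) (P : pred {set T}) :=
  forall A B : {set T}, A \subset B -> P B -> P A.

Lemma down_or (T : finType) (P Q : pred {set T}) :
  down P -> down Q -> down (predU P Q).
Proof.
by move=> dP dQ A B AB /= /orP[/(dP _ _ AB)|/(dQ _ _ AB)] ->//; rewrite orbT.
Qed.

(** Maps from a subcomplex of a simplex are represented by total functions that
    are only natural on that subcomplex, the latter being given by the family [P]
    of the sets of vertices of its simplices. *)
Definition natural_on N (P : pred {set 'I_N.+1}) (C : sset)
    (h : forall l, mono l N -> C l) :=
  forall k l (f : mono l N) (g : mono k l), P (mono_im f) ->
  h k (monoM f g) = act (h l f) g.

Definition agree_on N (P : pred {set 'I_N.+1}) (C : sset)
    (h h' : forall l, mono l N -> C l) :=
  forall l (f : mono l N), P (mono_im f) -> h l f = h' l f.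

(** * Extending partial maps over one more face *)

Section Extension.
Variable C : sset.

Lemma natural_on_sub N (P Q : pred {set 'I_N.+1}) (h : forall l, mono l N -> C l) :
  (forall D, Q D -> P D) -> natural_on P h -> natural_on Q h.
Proof. by move=> QP hP k l f g /QP/hP. Qed.

Lemma natural_on_comp m N (P : pred {set 'I_N.+1}) (h : forall l, mono l N -> C l)
    (s : mono m N) (Q : pred {set 'I_m.+1}) :
  (forall D, Q D -> P (s @: D)) -> natural_on P h ->
  natural_on Q (fun l f => h l (monoM s f)).
Proof. by move=> QP hP k l f g /QP; rewrite -monoA -mono_imM => /hP. Qed.

Lemma natural_on_act n N (x : C n) (s : mono N n) P :
  natural_on P (fun l (f : mono l N) => act x (monoM s f)).
Proof. by move=> k l f g _; rewrite actM monoA. Qed.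

Section Glue.
Variables (N : nat) (P1 P2 : pred {set 'I_N.+1}) (h1 h2 : forall l, mono l N -> C l).

Definition glue l (f : mono l N) : C l :=
  if P1 (mono_im f) then h1 f else h2 f.

Lemma glueL : agree_on P1 glue h1.
Proof. by move=> l f Pf; rewrite /glue Pf. Qed.

Hypotheses (d1 : down P1) (d2 : down P2).
Hypotheses (n1 : natural_on P1 h1) (n2 : natural_on P2 h2).
Hypothesis h12 : agree_on (predI P1 P2) h1 h2.

Lemma glueR : agree_on P2 glue h2.
Proof. by move=> l f Pf; rewrite /glue; case: ifP => // Pf'; apply: h12; apply/andP. Qed.

Lemma glue_natural : natural_on (predU P1 P2) glue.
Proof.
move=> k l f g /orP[] Pf; have fg := mono_imMS f g.
  by rewrite (glueL (d1 fg Pf)) (glueL Pf) n1.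
by rewrite (glueR (d2 fg Pf)) (glueR Pf) n2.
Qed.
End Glue.

(** All new simplices lie in the face [s], so [P'] is obtained by gluing part of that face to [P];
    the extension problem reduces to the face, where the retraction [r] supplies coordinates. *)
Lemma extend_along m N (s : mono m N) (r : mono N m) (P P' : pred {set 'I_N.+1})
    (h : forall l, mono l N -> C l) (k : forall l, mono l m -> C l) :
  monoM r s = mono1 m -> down P -> natural_on P h ->
  (forall D, P' D -> ~~ P D -> D \subset mono_im s) ->
  natural_on (fun D => P' (s @: D)) k ->
  agree_on (fun D => P (s @: D)) k (fun l f => h l (monoM s f)) ->
  exists2 h', natural_on P' h' & agree_on P h' h.
Proof.
move=> rs dP nh P'P nk kh.
exists (glue P h (fun l f => k l (monoM r f))); last exact: glueL.
move=> a l f g P'f; have [Pf|Pf] := boolP (P (mono_im f)).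
  by rewrite !(glueL _ _) ?nh//; apply: dP Pf; apply: mono_imMS.
have fs := mono_imK rs (P'P _ P'f Pf).
rewrite [in RHS]/glue (negPf Pf) -nk -?mono_imM ?fs//.
(* A face of a new simplex may already belong to [P]; there [kh] makes the two definitions agree. *)
rewrite /glue monoA; case: ifP => // Pfg.
have e : monoM s (monoM (monoM r f) g) = monoM f g by rewrite -monoA fs.
by rewrite -monoA (kh _ (monoM (monoM r f) g)) -?mono_imM ?e.
Qed.

(** [s] enumerates [A] in increasing order and [r] is the rank, the number of elements of [A] below
    a vertex. The rank is injective on [A], hence onto by counting. *)
Lemma mono_enum N (A : {set 'I_N.+1}) : A != set0 ->
  exists m (s : mono m N) (r : mono N m), monoM r s = mono1 m /\ mono_im s = A.
Proof.
move=> /set0Pn[a aA].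
have cA : (0 < #|A|)%N by apply/card_gt0P; exists a.
pose rk (x : 'I_N.+1) := #|[set y in A | (y < x)%N]|.
have rkS (x y : 'I_N.+1) : (x <= y)%N -> (rk x <= rk y)%N.
  move=> xy; apply/subset_leq_card/subsetP => z.
  by rewrite !inE => /andP[-> /=] /leq_trans; apply.
have rkA (x y : 'I_N.+1) : x \in A -> (x < y)%N -> (rk x < rk y)%N.
  move=> xA xy; apply: proper_card; apply/properP; split.
    by apply/subsetP => z; rewrite !inE => /andP[->] /ltn_trans; apply.
  by exists x; rewrite !inE xA// ltnn.
have rkI (x y : 'I_N.+1) : x \in A -> y \in A -> rk x = rk y -> x = y.
  move=> xA yA e; apply/val_inj; case: (ltngtP x y) => // /rkA.
    by move=> /(_ xA); rewrite e ltnn.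
  by move=> /(_ yA); rewrite e ltnn.
have rk_lt x : x \in A -> (rk x < #|A|)%N.
  move=> xA; apply: proper_card; apply/properP; split.
    by apply/subsetP => z; rewrite !inE => /andP[].
  by exists x; rewrite // !inE xA ltnn.
have cE : #|A|.-1.+1 = #|A| by rewrite prednK.
have rk_surj (i : 'I_#|A|.-1.+1) : exists2 x, x \in A & rk x = i.
  pose f (x : 'I_N.+1) : 'I_#|A|.-1.+1 := inord (rk x).
  have fE x : x \in A -> f x = rk x :> nat by move=> xA; rewrite inordK// cE rk_lt.
  have : i \in f @: A.
    suff -> : f @: A = [set: _] by rewrite inE.
    apply/eqP; rewrite eqEcard subsetT cardsT card_ord card_in_imset ?cE ?leqnn//.
    by move=> x y xA yA /(congr1 val); rewrite /= !fE//; apply: rkI.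
  by case/imsetP => x xA ->; exists x; rewrite ?fE.
pose s i := s2val (cid2 (rk_surj i)).
have sA i : s i \in A by rewrite /s; case: cid2.
have rks i : rk (s i) = i by rewrite /s; case: cid2.
clearbody s rk.
have s_homo : {homo s : i j / (i <= j)%N}.
  move=> i j ij; rewrite leqNgt; apply/negP => /(rkA _ _ (sA j)).
  by rewrite !rks ltnNge ij.
(* A vertex above all of [A] has rank [#|A|], one more than the last index, hence the cap. *)
pose r (x : 'I_N.+1) : 'I_#|A|.-1.+1 := inord (minn (rk x) #|A|.-1).
have r_homo : {homo r : i j / (i <= j)%N}.
  move=> x y xy; rewrite !inordK ?ltnS ?geq_minr//.
  by rewrite leq_min geq_minr andbT (leq_trans (geq_minl _ _))// rkS.
exists #|A|.-1, (Mono s_homo), (Mono r_homo); split.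
  apply: mono_eq => i; apply: val_inj.
  by rewrite /= /r rks (minn_idPl _) ?inord_val// -ltnS.
apply/setP => x; apply/mono_imP/idP => [[i <-]|xA]; first exact: sA.
have rx : (rk x < #|A|.-1.+1)%N by rewrite cE rk_lt.
by exists (Ordinal rx); apply: rkI; rewrite ?rks ?sA.
Qed.

(** Inside the simplex on [A], the family [P] is the horn at [v]: exactly [A] and the facet opposite
    [v] are missing. The vertices [u] and [w] of [A] on either side of [v] make this horn inner. *)
Lemma extend_horn N (P P' : pred {set 'I_N.+1}) (A : {set 'I_N.+1}) (u v w : 'I_N.+1)
    (h : forall l, mono l N -> C l) :
  quasicategory C -> down P -> natural_on P h ->
  [/\ u \in A, v \in A & w \in A] -> (u < v < w)%N ->
  (forall D : {set _}, D \subset A -> P D = (D != A) && (D != A :\ v)) ->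
  (forall D, P' D -> ~~ P D -> D = A \/ D = A :\ v) ->
  exists2 h', natural_on P' h' & agree_on P h' h.
Proof.
move=> qC dP nh [uA vA wA] uvw PA P'A.
have /mono_enum[m [s [r [rs sA]]]] : A != set0 by apply/set0Pn; exists u.
have [iu [iv [iw [su sv sw]]]] : exists iu iv iw, [/\ s iu = u, s iv = v & s iw = w].
  move: uA vA wA; rewrite -sA => /mono_imP[iu su] /mono_imP[iv sv] /mono_imP[iw sw].
  by exists iu, iv, iw.
have slt i j : (s i < s j)%N -> (i < j)%N.
  by rewrite !ltnNge; apply: contra; apply: mono_le.
have /andP[iuv ivw] : (iu < iv < iw)%N.
  by case/andP: uvw => uv vw; rewrite !slt// ?su ?sv ?sw.
have imS (D : {set 'I_m.+1}) : s @: D \subset A.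
  by apply/subsetP => _ /imsetP[i _ ->]; rewrite -sA mem_mono_im.
have sK := monoKL rs; have sI := can_inj sK.
have hornP l (f : mono l m) : in_horn iv f <-> P (s @: mono_im f).
  rewrite PA//; split=> [[j jv fj]|/andP[fA fAv]].
    have sj : s j \notin s @: mono_im f.
      apply/imsetP => -[_ /mono_imP[i <-]] /sI e.
      by move: (fj i); rewrite e eqxx.
    have jA : s j \in A by rewrite -sA mem_mono_im.
    apply/andP; split; apply: contraNneq sj => ->//.
    by rewrite !inE jA -sv (inj_eq sI) jv.
  have [fv|/subsetPn[j]] := boolP (A :\ v \subset s @: mono_im f).
    have [vf|vf] := boolP (v \in s @: mono_im f); exfalso.
      by move: fA; rewrite eqEsubset imS/= -(setD1K vA) subUset sub1set vf fv.
    move: fAv; rewrite eqEsubset fv andbT => /negP; apply.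
    by apply/subsetD1P; rewrite imS.
  rewrite !inE => /andP[jv]; rewrite -sA => /mono_imP[i e]; rewrite -e => nf.
  exists i; first by apply: contraNneq jv => iE; rewrite -e iE sv.
  move=> k; apply: contraNneq nf => <-.
  by rewrite imset_f// mem_mono_im.
pose b l (f : horn iv l) : C l := h l (monoM s (sval f)).
have bn k l (f : horn iv l) (g : mono k l) : b k (act f g) = act (b l f) g.
  rewrite /b /= -monoA nh// mono_imM; apply/hornP; exact: svalP f.
have [|x xP] := qC m iv _ (SMap bn).
  by rewrite (leq_ltn_trans _ iuv)// (leq_trans ivw)// -ltnS.
apply: (@extend_along _ _ s r P P' h (fun l f => act x f)) => //.
- by move=> D P'D /(P'A _ P'D)[]->; rewrite sA// subD1set.
- by move=> k l f g _; rewrite actM.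
- by move=> l f /hornP hf; rewrite -(xP l (exist _ f hf)).
Qed.
End Extension.

(** * Joins *)

Section Join.
Variables m n : nat.
Implicit Types (A : {set 'I_m.+1}) (B : {set 'I_n.+1}) (D : {set 'I_(m + n.+1).+1}).

Lemma join_ordP (i : 'I_(m + n.+1).+1) :
  (exists a, i = mono_inl m n a) \/ (exists b, i = mono_inr m n b).
Proof.
by case: (split_ordP (i : 'I_(m.+1 + n.+1))) => [a|b] ->; [left; exists a|right; exists b].
Qed.

Definition low D : {set 'I_m.+1} := mono_inl m n @^-1: D.
Definition high D : {set 'I_n.+1} := mono_inr m n @^-1: D.

Definition join (A : {set 'I_m.+1}) (B : {set 'I_n.+1}) :
  {set 'I_(m + n.+1).+1} := (mono_inl m n @: A) :|: (mono_inr m n @: B).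

Lemma mono_inl_inj : injective (mono_inl m n).
Proof. exact: (@lshift_inj m.+1 n.+1). Qed.

Lemma mono_inr_inj : injective (mono_inr m n).
Proof. exact: (@rshift_inj m.+1 n.+1). Qed.

Lemma mono_inl_inr a b : (mono_inl m n a == mono_inr m n b) = false.
Proof. exact: (@eq_lrshift m.+1 n.+1). Qed.

Lemma mono_inr_inl a b : (mono_inr m n b == mono_inl m n a) = false.
Proof. by rewrite eq_sym mono_inl_inr. Qed.

Lemma low_join A B : low (join A B) = A.
Proof.
apply/setP => a; rewrite !inE mem_imset; last exact: mono_inl_inj.
by rewrite orbC; case: imsetP => [[b _ /eqP]|//]; rewrite mono_inl_inr.
Qed.

Lemma high_join A B : high (join A B) = B.
Proof.
apply/setP => a; rewrite !inE orbC mem_imset; last exact: mono_inr_inj.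
by rewrite orbC; case: imsetP => [[b _ /eqP]|//]; rewrite mono_inr_inl.
Qed.

Lemma joinK D : join (low D) (high D) = D.
Proof.
apply/setP => i; have [[a ->]|[b ->]] := join_ordP i.
  have -> : (mono_inl m n a \in join (low D) (high D)) = (a \in low (join (low D) (high D))).
    by rewrite [RHS]inE.
  by rewrite low_join inE.
have -> : (mono_inr m n b \in join (low D) (high D)) = (b \in high (join (low D) (high D))).
  by rewrite [RHS]inE.
by rewrite high_join inE.
Qed.

Lemma lowS D D' : D \subset D' -> low D \subset low D'.
Proof. by move=> DD'; apply: preimsetS. Qed.

Lemma highS D D' : D \subset D' -> high D \subset high D'.
Proof. by move=> DD'; apply: preimsetS. Qed.

Lemma joinS A B D : (D \subset join A B) = (low D \subset A) && (high D \subset B).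
Proof.
apply/idP/andP => [DAB|[lA hB]].
  by split; [rewrite -(low_join A B) lowS|rewrite -(high_join A B) highS].
by rewrite -(joinK D) setUSS// imsetS.
Qed.

Lemma eq_join A B D : (D == join A B) = (low D == A) && (high D == B).
Proof.
apply/eqP/andP => [->|[/eqP<- /eqP<-]]; last by rewrite joinK.
by rewrite low_join high_join !eqxx.
Qed.

Lemma join_inl A B a : (mono_inl m n a \in join A B) = (a \in A).
Proof. by rewrite -[in RHS](low_join A B) [RHS]inE. Qed.

Lemma join_inr A B b : (mono_inr m n b \in join A B) = (b \in B).
Proof. by rewrite -[in RHS](high_join A B) [RHS]inE. Qed.

Lemma low_inl A : low (mono_inl m n @: A) = A.
Proof. by rewrite -[RHS](low_join A set0) /join imset0 setU0. Qed.

Lemma high_inl A : high (mono_inl m n @: A) = set0.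
Proof. by rewrite -[RHS](high_join A set0) /join imset0 setU0. Qed.

Lemma low_inr B : low (mono_inr m n @: B) = set0.
Proof. by rewrite -[RHS](low_join set0 B) /join imset0 set0U. Qed.

Lemma high_inr B : high (mono_inr m n @: B) = B.
Proof. by rewrite -[RHS](high_join set0 B) /join imset0 set0U. Qed.

(** The join of two subcomplexes. A simplex contained in one summand has an empty component in the
    other, so the summands themselves belong to it when the families contain [set0]. *)
Definition fam (F : pred {set 'I_m.+1}) (G : pred {set 'I_n.+1}) D :=
  F (low D) && G (high D).

Lemma down_fam F G : down F -> down G -> down (fam F G).
Proof.
by move=> dF dG D D' DD' /andP[/(dF _ _ (lowS DD')) ? /(dG _ _ (highS DD')) ?]; apply/andP.
Qed.
End Join.

Section JoinSum.
Variables (m n m' n' : nat) (f : mono m' m) (g : mono n' n).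
Implicit Type D : {set 'I_(m' + n'.+1).+1}.

Lemma mono_sumL a : mono_sum f g (mono_inl m' n' a) = mono_inl m n (f a).
Proof. exact: mono_sum_inl. Qed.

Lemma mono_sumR b : mono_sum f g (mono_inr m' n' b) = mono_inr m n (g b).
Proof. exact: mono_sum_inr. Qed.

Lemma mono_sum_im D : mono_sum f g @: D = join (f @: low D) (g @: high D).
Proof.
rewrite -{1}(joinK D) /join imsetU -!imset_comp; congr (_ :|: _).
  by apply: eq_imset => a; apply: mono_sum_inl.
by apply: eq_imset => b; apply: mono_sum_inr.
Qed.

Lemma mono_im_sum : mono_im (mono_sum f g) = join (mono_im f) (mono_im g).
Proof.
have imT a b (e : mono a b) : mono_im e = e @: setT.
  apply/setP => j; apply/mono_imP/imsetP => [[i <-]|[i _ ->]]; first by exists i.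
  by exists i.
rewrite !imT mono_sum_im.
have -> : low [set: 'I_(m' + n'.+1).+1] = setT by apply/setP => x; rewrite !inE.
by have -> : high [set: 'I_(m' + n'.+1).+1] = setT by apply/setP => x; rewrite !inE.
Qed.

Lemma low_sum D : low (mono_sum f g @: D) = f @: low D.
Proof. by rewrite mono_sum_im low_join. Qed.

Lemma high_sum D : high (mono_sum f g @: D) = g @: high D.
Proof. by rewrite mono_sum_im high_join. Qed.
End JoinSum.

(** * Lifting cones along an inclusion of subcomplexes *)

Section Extendable.
Variables (C : sset) (m : nat) (k : forall l, mono l m -> C l).
Implicit Types (F : pred {set 'I_m.+1}) (A : {set 'I_m.+1}) (v : 'I_m.+1).

Definition restricts n (F : pred {set 'I_m.+1}) (h : forall l, mono l (m + n.+1) -> C l) :=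
  agree_on F (fun l f => h l (monoM (mono_inl m n) f)) k.

(** For the inclusion of the subcomplexes of [Delta m] given by [F] and [F'], this
    says that the map from the coslice of [C] under [k] on [F'] to the coslice under
    [k] on [F] has the right lifting property against inclusions of subcomplexes
    of simplices. *)
Definition extendable F F' :=
  forall n (G G' : pred {set 'I_n.+1}), down G -> down G' -> G set0 ->
  (forall B, G B -> G' B) ->
  forall h : forall l, mono l (m + n.+1) -> C l,
  natural_on (predU (fam F G') (fam F' G)) h -> restricts F' h ->
  exists2 h', natural_on (fam F' G') h' &
    agree_on (predU (fam F G') (fam F' G)) h' h.

(** The sets in [G'] but not in [G] are attached one at a time by increasing size, so that the
    boundary of [B] is present when [B] is reached. *)
Lemma extendable_step F F' : down F -> down F' ->
  (forall n (G G' : pred {set 'I_n.+1}) B, down G -> down G' -> G set0 ->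
    G' B -> ~~ G B -> (forall B' : {set _}, B' \proper B -> G B') ->
    forall h : forall l, mono l (m + n.+1) -> C l,
    natural_on (predU (fam F G') (fam F' G)) h -> restricts F' h ->
    exists2 h',
      natural_on (predU (fam F G') (fam F' [pred X | G X || (X == B)])) h' &
      agree_on (predU (fam F G') (fam F' G)) h' h) ->
  extendable F F'.
Proof.
move=> dF dF' step n G G' + dG'.
have [N] := ubnP #|[set B | G' B && ~~ G B]|; elim: N G => // N IH G.
rewrite ltnS => cG dG G0 GG' h nh kh.
have [/eqP B0|/set0Pn[B1]] := boolP ([set B | G' B && ~~ G B] == set0).
  exists h => // l a f g /andP[F'f G'f]; apply: nh; apply/orP; right.
  rewrite /fam F'f/=; apply/negPn/negP => nG.
  by move/setP/(_ (high (mono_im f))): B0; rewrite !inE G'f nG.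
rewrite inE => B1G.
have [B /andP[G'B nGB] Bmin] :=
  @arg_minnP _ B1 [pred B | G' B && ~~ G B] (fun B : {set 'I_n.+1} => #|B|) B1G.
have Bproper (B' : {set _}) : B' \proper B -> G B'.
  move=> B'B; apply/negPn/negP => nGB'; have := proper_card B'B.
  rewrite ltnNge Bmin//= nGB' andbT.
  by apply: dG' G'B; apply: proper_sub.
have [h1 nh1 h1h] := step n G G' B dG dG' G0 G'B nGB Bproper h nh kh.
have dG1 : down [pred X | G X || (X == B)].
  move=> X Y XY /= /orP[/(dG _ _ XY) ->//|/eqP YB].
  by move: XY; rewrite YB subEproper orbC => /orP[/Bproper->|->]; rewrite ?orbT.
have [||||h2 nh2 h2h1] := IH [pred X | G X || (X == B)] _ dG1 _ _ h1 nh1 _.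
- apply: leq_trans cG; apply: proper_card; apply/properP; split.
    by apply/subsetP => X; rewrite !inE negb_or => /and3P[-> ->].
  by exists B; rewrite !inE G'B ?nGB// eqxx orbT.
- by rewrite /= G0.
- by move=> X /= /orP[/GG'//|/eqP->].
- move=> l f F'f; rewrite h1h ?kh// mono_imM /fam /= low_inl high_inl.
  by rewrite F'f G0 orbT.
exists h2 => // l f hf; rewrite h2h1 ?h1h//.
by rewrite /= /fam; case/orP: hf => /andP[-> /= ->]//; rewrite orbT.
Qed.

(** The first extension lives on [fam F2 G']. To pose the second lifting problem it is glued to the
    original [h] on [fam F3 G]. *)
Lemma extendable_trans F1 F2 F3 : down F1 -> down F2 -> down F3 ->
  (forall D, F1 D -> F2 D) -> (forall D, F2 D -> F3 D) ->
  extendable F1 F2 -> extendable F2 F3 -> extendable F1 F3.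
Proof.
move=> d1 d2 d3 F12 F23 e12 e23 n G G' dG dG' G0 GG' h nh kh.
have [||h1 nh1 h1h] := e12 n G G' dG dG' G0 GG' h.
- apply: natural_on_sub nh => D /orP[]/andP[/= FD GD]; apply/orP; [left|right].
    by rewrite /fam FD.
  by rewrite /fam F23.
- by move=> l f F2f; apply: kh; apply: F23.
have h1h' : agree_on (predI (fam F2 G') (fam F3 G)) h1 h.
  move=> l f /andP[/= /andP[F2f _] /andP[_ Gf]]; apply: h1h.
  by rewrite /= /fam F2f Gf orbT.
have nh3 : natural_on (fam F3 G) h.
  by apply: natural_on_sub nh => D /= ->; rewrite orbT.
have d2G' := down_fam d2 dG'; have d3G := down_fam d3 dG.
have [|h2 nh2 h2h] := e23 n G G' dG dG' G0 GG' _ (glue_natural d2G' d3G nh1 nh3 h1h').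
  move=> l f F3f; rewrite (glueR h1h') ?kh//.
  by rewrite mono_imM /fam low_inl high_inl F3f.
exists h2 => // l f /orP[]/andP[/= Ff Gf].
  have F2f : fam F2 G' (mono_im f) by rewrite /fam F12.
  by rewrite h2h /= ?F2f// glueL// h1h//= /fam Ff Gf.
have F3f : fam F3 G (mono_im f) by rewrite /fam Ff.
by rewrite h2h /= ?F3f ?orbT// (glueR h1h').
Qed.

(** The effect of filling the horn of [A] at [v], which adds the simplex and its missing facet
    together. *)
Definition add_cell F (A : {set 'I_m.+1}) (v : 'I_m.+1) : pred {set 'I_m.+1} :=
  fun D => [|| F D, D == A | D == A :\ v].

Lemma down_add_cell F A v : down F ->
  (forall D : {set _}, D \subset A -> F D = (D != A) && (D != A :\ v)) ->
  down (add_cell F A v).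
Proof.
move=> dF FA D E DE /or3P[/(dF _ _ DE)|/eqP EA|/eqP EA].
- by rewrite /add_cell => ->.
- by rewrite /add_cell FA -?EA//; case: eqP => //=; case: eqP.
- rewrite /add_cell FA; first by case: eqP => //=; case: eqP.
  by apply: subset_trans DE _; rewrite EA subD1set.
Qed.

(** The join of an inner or right horn with a simplex, relative to the boundary of
    the latter, is an inner horn. *)
Lemma extendable_cell F A (u v : 'I_m.+1) : quasicategory C -> down F ->
  (u < v)%N -> u \in A -> v \in A ->
  (forall D : {set _}, D \subset A -> F D = (D != A) && (D != A :\ v)) ->
  extendable F (add_cell F A v).
Proof.
move=> qC dF uv uA vA FA; have dF' := down_add_cell dF FA.
apply: extendable_step => // n G G' B dG dG' G0 G'B nGB GB h nh _.
(* Every vertex of [B] comes after [v] in the join, so the horn there is inner even if [v] is the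
   last vertex of [A]. *)
have [w wB] : exists w, w \in B by apply/set0Pn; apply: contraNneq nGB => ->.
have joinD1 : join A B :\ mono_inl m n v = join (A :\ v) B.
  apply/eqP; rewrite eq_join; apply/andP; split; apply/eqP/setP => x.
    by rewrite [LHS]inE !in_setD1 join_inl (inj_eq (@mono_inl_inj m n)).
  by rewrite [LHS]inE in_setD1 join_inr mono_inr_inl.
apply: (extend_horn (A := join A B) (u := mono_inl m n u) (v := mono_inl m n v)
  (w := mono_inr m n w)) => //.
- by apply: down_or; apply: down_fam.
- by rewrite !join_inl join_inr.
- by rewrite /= uv /= (leq_trans (ltn_ord v))// leq_addr.
- move=> D; rewrite joinS joinD1 !eq_join => /andP[lA hB].
  rewrite /= /fam /add_cell; have [hE|hN] := eqVneq (high D) B.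
    by rewrite hE G'B (negPf nGB) !andbT andbF orbF FA.
  rewrite GB ?properEneq ?hN// !andbF /= andbT FA//.
  by case: (low D == A); case: (low D == _); rewrite ?orbT.
- move=> D /orP[/= DP|/=/andP[F'D /= /orP[GD|/eqP DB]]].
  + by rewrite DP.
  + by rewrite /fam F'D GD orbT.
  + rewrite /fam DB G'B andbT negb_or joinD1 => /andP[nF _].
    move: F'D; rewrite /add_cell (negPf nF)/=.
    by case/orP => /eqP lD; [left|right]; apply/eqP; rewrite eq_join DB lD !eqxx.
Qed.
End Extendable.

(** * Coslices *)

Section Cut.
Variables m n : nat.

Lemma lretr_homo :
  {homo (fun i : 'I_(m + n.+1).+1 => inord (minn i m) : 'I_m.+1) : i j / (i <= j)%N}.
Proof.
move=> i j ij; rewrite !inordK ?ltnS ?geq_minr// leq_min geq_minr andbT.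
exact: leq_trans (geq_minl _ _) ij.
Qed.

Definition lretr : mono (m + n.+1) m := Mono lretr_homo.

Lemma rretr_bound (i : 'I_(m + n.+1).+1) : (i - m.+1 < n.+1)%N.
Proof. by rewrite ltn_psubLR//; apply: ltn_ord i. Qed.

Lemma rretr_homo :
  {homo (fun i : 'I_(m + n.+1).+1 => Ordinal (rretr_bound i)) : i j / (i <= j)%N}.
Proof. by move=> i j ij; rewrite /= leq_sub2r. Qed.

Definition rretr : mono (m + n.+1) n := Mono rretr_homo.

Lemma lretr_inl a : lretr (mono_inl m n a) = a.
Proof.
by apply: val_inj; rewrite /= inordK ?ltnS ?geq_minr// (minn_idPl _)// -ltnS.
Qed.

Lemma rretr_inr b : rretr (mono_inr m n b) = b.
Proof. by apply: val_inj; rewrite /= addnC addnK. Qed.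

Lemma inl_lretr (i : 'I_(m + n.+1).+1) : (i < m.+1)%N -> mono_inl m n (lretr i) = i.
Proof.
have [[a ->]|[b ->]] := join_ordP i; first by rewrite lretr_inl.
by rewrite /= ltnNge leq_addr.
Qed.

Lemma inr_rretr (i : 'I_(m + n.+1).+1) : (m < i)%N -> mono_inr m n (rretr i) = i.
Proof.
have [[a ->]|[b ->]] := join_ordP i; last by rewrite rretr_inr.
by rewrite /= ltnNge -ltnS ltn_ord.
Qed.

Lemma inl_lt a : (mono_inl m n a < m.+1)%N.
Proof. exact: (ltn_ord a). Qed.

Lemma inr_gt b : (mono_inr m n b < m.+1)%N = false.
Proof. by rewrite /= ltnNge leq_addr. Qed.

Variable l : nat.

Lemma lo_homo a :
  {homo (fun i : 'I_l.+1 => inord (minn i a.-1) : 'I_l.+1) : i j / (i <= j)%N}.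
Proof.
move=> i j ij; rewrite !inordK; try by rewrite (leq_ltn_trans (geq_minl _ _)).
by rewrite leq_min geq_minr andbT (leq_trans (geq_minl _ _) ij).
Qed.

Definition lo a : mono l l := Mono (@lo_homo a).

Lemma hi_homo a :
  {homo (fun i : 'I_l.+1 => inord (maxn i (minn a l)) : 'I_l.+1) : i j / (i <= j)%N}.
Proof.
have B (i : 'I_l.+1) : (maxn i (minn a l) < l.+1)%N.
  by rewrite ltnS geq_max geq_minr andbT -ltnS.
by move=> i j ij; rewrite !inordK// geq_max leq_maxr andbT (leq_trans ij)// leq_maxl.
Qed.

Definition hi a : mono l l := Mono (@hi_homo a).

Lemma lo_lt a i : (0 < a)%N -> (lo a i < a)%N.
Proof.
case: a => // a _; rewrite /= inordK ?ltnS ?geq_minr//.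
by rewrite (leq_trans (geq_minl _ _))// -ltnS.
Qed.

Lemma lo_id a (i : 'I_l.+1) : (i < a)%N -> lo a i = i.
Proof.
case: a => // a ia; apply: val_inj.
by rewrite /= (minn_idPl _) ?inord_val.
Qed.

Lemma hi_ge a i : (a <= l)%N -> (a <= hi a i)%N.
Proof.
move=> al; rewrite /= (minn_idPl al) inordK; first exact: leq_maxr.
by rewrite ltnS geq_max al -ltnS ltn_ord.
Qed.

Lemma hi_id a (i : 'I_l.+1) : (a <= i)%N -> hi a i = i.
Proof.
move=> ai; apply: val_inj; rewrite /= (maxn_idPl _) ?inord_val//.
exact: leq_trans (geq_minl _ _) ai.
Qed.

Lemma zigzag_homo a :
  {homo (fun i : 'I_l.+1 => if (i < a)%N then mono_inl l l i else mono_inr l l i) :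
    i j / (i <= j)%N}.
Proof.
move=> i j ij; case: ifP => ia; case: ifP => ja /=.
- by [].
- by rewrite (leq_trans (ltnW (ltn_ord i)))// leq_addr.
- by rewrite (leq_ltn_trans ij ja) in ia.
- by rewrite leq_add2l.
Qed.

(** A path through the join of two copies of [Delta l] that changes copy at position [a].
    Restricting to it the join of two components padded to dimension [l] recovers a simplex meeting
    both summands, without splitting [l] as a sum. *)
Definition zigzag a : mono l (l + l.+1) := Mono (@zigzag_homo a).

Lemma zigzagE a (i : 'I_l.+1) :
  zigzag a i = if (i < a)%N then mono_inl l l i else mono_inr l l i.
Proof. by []. Qed.

Implicit Type f : mono l (m + n.+1).

Definition cut f := #|[set i | (f i < m.+1)%N]|.

Lemma card_initial (i : nat) : (i <= l.+1)%N -> #|[set j : 'I_l.+1 | (j < i)%N]| = i.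
Proof.
by move=> il; rewrite -sum1dep_card (big_ord_narrow il) sum1_card card_ord.
Qed.

(** By monotonicity the vertices sent to the left summand form an initial segment, so their number
    locates the cut. *)
Lemma cutP f (i : 'I_l.+1) : (i < cut f)%N = (f i < m.+1)%N.
Proof.
have [fi|fi] := ltnP (f i) m.+1.
  rewrite -[i.+1](card_initial (ltn_ord i)) /cut; apply/subset_leq_card/subsetP => j.
  by rewrite !inE ltnS => /(mono_le f)/leq_ltn_trans; apply.
apply/negbTE; rewrite -leqNgt -[leqRHS](card_initial (ltnW (ltn_ord i))).
apply/subset_leq_card/subsetP => j.
by rewrite !inE; apply: contraTltn => /(mono_le f); rewrite -leqNgt; apply: leq_trans.
Qed.

(** The two components of [f]; each is constant on the vertices that [f] sends to
    the other summand, which makes both simplices of dimension [l]. *)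
Definition lpart f : mono l m := monoM lretr (monoM f (lo (cut f))).
Definition rpart f : mono l n := monoM rretr (monoM f (hi (cut f))).

Lemma cut_inl a : cut (monoM (mono_inl m n) a) = l.+1.
Proof.
rewrite /cut (_ : [set _ | _] = setT) ?cardsT ?card_ord//.
by apply/setP => i; rewrite !inE inl_lt.
Qed.

Lemma cut_inr b : cut (monoM (mono_inr m n) b) = 0.
Proof.
rewrite /cut (_ : [set _ | _] = set0) ?cards0//.
by apply/setP => i; rewrite !inE inr_gt.
Qed.

Lemma lpart_inl a : lpart (monoM (mono_inl m n) a) = a.
Proof.
apply: mono_eq => i; rewrite !monoMx cut_inl lo_id//.
exact: lretr_inl.
Qed.

Lemma rpart_inr b : rpart (monoM (mono_inr m n) b) = b.
Proof.
apply: mono_eq => i; rewrite !monoMx cut_inr hi_id//.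
exact: rretr_inr.
Qed.

Lemma cut_trichotomy f :
  [\/ exists a, f = monoM (mono_inl m n) a, exists b, f = monoM (mono_inr m n) b |
      (0 < cut f <= l)%N].
Proof.
have [c0|c0] := posnP (cut f).
  constructor 2; exists (monoM rretr f); apply: mono_eq => i.
  by rewrite !monoMx inr_rretr// -ltnS ltnNge -cutP c0.
have [cl|cl] := leqP (cut f) l; first by constructor 3.
constructor 1; exists (monoM lretr f); apply: mono_eq => i.
by rewrite !monoMx inl_lretr// -cutP (leq_trans _ cl).
Qed.

Section Mixed.
Variable f : mono l (m + n.+1).
Hypothesis fP : (0 < cut f <= l)%N.

Lemma lo_lpart i : (f (lo (cut f) i) < m.+1)%N.
Proof. by rewrite -cutP lo_lt//; case/andP: fP. Qed.

Lemma hi_rpart i : (m < f (hi (cut f) i))%N.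
Proof. by rewrite -ltnS ltnNge -cutP -leqNgt hi_ge//; case/andP: fP. Qed.

Lemma lpart_rpartK : monoM (mono_sum (lpart f) (rpart f)) (zigzag (cut f)) = f.
Proof.
apply: mono_eq => i; rewrite monoMx zigzagE; case: ifP => ic.
  rewrite mono_sumL !monoMx lo_id//.
  by rewrite inl_lretr// -cutP.
rewrite mono_sumR !monoMx hi_id; last first.
  by rewrite leqNgt ic.
by rewrite inr_rretr// -ltnS ltnNge -cutP ic.
Qed.

Lemma lpart_im : mono_im (lpart f) \subset low (mono_im f).
Proof.
apply/subsetP => _ /mono_imP[i <-]; rewrite inE.
by rewrite !monoMx inl_lretr ?mem_mono_im// lo_lpart.
Qed.

Lemma rpart_im : mono_im (rpart f) \subset high (mono_im f).
Proof.
apply/subsetP => _ /mono_imP[i <-]; rewrite inE.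
by rewrite !monoMx inr_rretr ?mem_mono_im// hi_rpart.
Qed.
End Mixed.
End Cut.

Section CutSum.
Variables (m n r s l : nat) (a : mono r m) (b : mono s n) (d : mono l (r + s.+1)).

Lemma sum_lt i : (mono_sum a b i < m.+1)%N = (i < r.+1)%N.
Proof.
have [[x ->]|[y ->]] := join_ordP i.
  by rewrite mono_sumL !inl_lt.
by rewrite mono_sumR !inr_gt.
Qed.

Lemma cut_sum : cut (monoM (mono_sum a b) d) = cut d.
Proof. by rewrite /cut; congr #|pred_of_set _|; apply/setP => i; rewrite !inE -sum_lt. Qed.

Hypothesis dP : (0 < cut d <= l)%N.

Lemma lpart_sum : lpart (monoM (mono_sum a b) d) = monoM a (lpart d).
Proof.
apply: mono_eq => i; rewrite /lpart cut_sum !monoMx.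
rewrite -{1}(inl_lretr (lo_lpart dP i)) mono_sumL.
exact: lretr_inl.
Qed.

Lemma rpart_sum : rpart (monoM (mono_sum a b) d) = monoM b (rpart d).
Proof.
apply: mono_eq => i; rewrite /rpart cut_sum !monoMx.
rewrite -{1}(inr_rretr (hi_rpart dP i)) mono_sumR.
exact: rretr_inr.
Qed.
End CutSum.

Definition proper_faces n : pred {set 'I_n.+1} := fun B => B != setT.
Arguments proper_faces n /.

Lemma down_proper_faces n : down (@proper_faces n).
Proof. by move=> A B AB /=; apply: contraNneq => A1; rewrite -subTset -A1. Qed.

Lemma down_predT (T : finType) : down (predT : pred {set T}).
Proof. by []. Qed.

Lemma in_boundaryP n l (f : mono l n) : in_boundary f <-> proper_faces (mono_im f).
Proof.
split=> [[j jf]|].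
  apply/negP => /eqP /setP/(_ j); rewrite inE => /mono_imP[i ij].
  by move: (jf i); rewrite ij eqxx.
rewrite /= -subTset => /subsetPn[j _ jf]; exists j => i.
by apply: contraNneq jf => <-; apply: mem_mono_im.
Qed.

(** [k] represents a cone under its restriction to [F]; the property says that it
    is an initial object of the coslice. *)
Definition initial_cone (C : sset) m (F : pred {set 'I_m.+1})
    (k : forall l, mono l (m + 1) -> C l) :=
  forall n, (0 < n)%N -> forall h : forall l, mono l (m + n.+1) -> C l,
  natural_on (fam F (@proper_faces n)) h ->
  agree_on (fam F predT)
    (fun l f => h l (monoM (mono_sum (mono1 m) (mono_cst 0 ord0)) f)) k ->
  exists2 h', natural_on (fam F predT) h' &
    agree_on (fam F (@proper_faces n)) h' h.

(** A subcomplex [K] of the simplex [Delta m], with the family [F] of the sets of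
    vertices of its simplices. *)
Section Coordinates.
Variables (C K : sset) (m : nat) (F : pred {set 'I_m.+1}).
Variables (iota : smap K (Delta m)) (kappa : forall l, mono l m -> K l).
Hypotheses (dF : down F) (iotaF : forall l (x : K l), F (mono_im (iota l x))).
Hypothesis nkappa : natural_on F kappa.
Hypotheses (kappaK : forall l (f : mono l m), F (mono_im f) -> iota l (kappa f) = f)
  (iotaK : forall l (x : K l), kappa (iota l x) = x).
Variable p : smap K C.

Section Unjoin.
Variables (n : nat) (Q : pred {set 'I_n.+1}).
Variable beta : forall l, mono l n -> coslice p l.
Hypotheses (dQ : down Q) (nbeta : natural_on Q beta).

(** One direction of the adjunction between join and coslice: a partial map [beta] from [Delta n] to
    the coslice becomes a partial map from the join to [C]. Since [cone] has values on full joins of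
    simplices, a simplex meeting both summands is cut and pulled back along [zigzag]. *)
Definition unjoin l (f : mono l (m + n.+1)) : C l :=
  if cut f == l.+1 then p l (kappa (lpart f))
  else if cut f == 0 then apex (beta (rpart f))
  else act (cone (beta (rpart f)) (kappa (lpart f))) (zigzag l (cut f)).

Lemma unjoin_inl l (a : mono l m) :
  unjoin (monoM (mono_inl m n) a) = p l (kappa a).
Proof. by rewrite /unjoin cut_inl eqxx lpart_inl. Qed.

Lemma unjoin_inr l (b : mono l n) :
  unjoin (monoM (mono_inr m n) b) = apex (beta b).
Proof. by rewrite /unjoin cut_inr /= rpart_inr. Qed.

(** The value does not depend on the join [mono_sum a b] through which the simplex is presented,
    because [cone] is natural in both factors. Naturality of [unjoin] on mixed simplices rests on
    this. *)
Lemma unjoin_mixed r s l (a : mono r m) (b : mono s n) (d : mono l (r + s.+1)) :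
  F (mono_im a) -> Q (mono_im b) -> (0 < cut d <= l)%N ->
  unjoin (monoM (mono_sum a b) d) = act (cone (beta b) (kappa a)) d.
Proof.
move=> Fa Qb dP; rewrite /unjoin cut_sum lpart_sum// rpart_sum//.
case/andP: (dP) => d0 dl; rewrite ltn_eqF ?ltnS// gtn_eqF//.
rewrite nbeta// nkappa// cone_act /= !actM -monoA mono_sumM monoM1 mono1M.
by rewrite lpart_rpartK.
Qed.

Lemma unjoin_sum r s (a : mono r m) (b : mono s n) :
  F (mono_im a) -> Q (mono_im b) -> unjoin (mono_sum a b) = cone (beta b) (kappa a).
Proof.
move=> Fa Qb; rewrite -[mono_sum a b]monoM1 unjoin_mixed ?act1//.
have [[e /(congr1 (fun f : mono _ _ => f (mono_inr r s ord0)))]|[e]|//] :=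
  cut_trichotomy (mono1 (r + s.+1)).
- by rewrite monoMx mono1E => /eqP; rewrite mono_inr_inl.
- move/(congr1 (fun f : mono _ _ => f (mono_inl r s ord0))).
  by rewrite monoMx mono1E => /eqP; rewrite mono_inl_inr.
Qed.

Lemma fam_mixed l (f : mono l (m + n.+1)) :
  fam F Q (mono_im f) -> (0 < cut f <= l)%N ->
  F (mono_im (lpart f)) /\ Q (mono_im (rpart f)).
Proof.
move=> /andP[Ff Qf] fP; split; first by apply: dF Ff; apply: lpart_im.
by apply: dQ Qf; apply: rpart_im.
Qed.

Lemma unjoin_natural : natural_on (fam F Q) unjoin.
Proof.
move=> k l f g FQf; case: (cut_trichotomy f) => [[a fE]|[b fE]|fP].
- move: FQf; rewrite fE monoA !unjoin_inl /fam mono_imM low_inl => /andP[Fa _].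
  by rewrite nkappa// smap_act.
- move: FQf; rewrite fE monoA !unjoin_inr /fam mono_imM high_inr => /andP[_ Qb].
  by rewrite nbeta.
have [Fl Qr] := fam_mixed FQf fP.
move: (cut f) (lpart f) (rpart f) (lpart_rpartK f) Fl Qr => c a b fE Fa Qb.
rewrite -fE in fP *; rewrite cut_sum in fP.
rewrite (unjoin_mixed Fa Qb)// monoA.
case: (cut_trichotomy (monoM (zigzag l c) g)) => [[e eE]|[e eE]|gP].
- rewrite actM eE -monoA mono_sum_comp_inl monoA unjoin_inl nkappa//.
  by rewrite smap_act -actM cone_inl.
- rewrite actM eE -monoA mono_sum_comp_inr monoA unjoin_inr nbeta//.
  by rewrite -actM cone_inr.
- by rewrite unjoin_mixed// actM.
Qed.

Lemma agree_on_fam (h h' : forall l, mono l (m + n.+1) -> C l) :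
  natural_on (fam F Q) h -> natural_on (fam F Q) h' ->
  (forall l a, F (mono_im a) ->
    h l (monoM (mono_inl m n) a) = h' l (monoM (mono_inl m n) a)) ->
  (forall l b, Q (mono_im b) ->
    h l (monoM (mono_inr m n) b) = h' l (monoM (mono_inr m n) b)) ->
  (forall r s (a : mono r m) (b : mono s n), F (mono_im a) -> Q (mono_im b) ->
    h _ (mono_sum a b) = h' _ (mono_sum a b)) ->
  agree_on (fam F Q) h h'.
Proof.
move=> nh nh' hl hr hs l f FQf; case: (cut_trichotomy f) => [[a fE]|[b fE]|fP].
- by move: FQf; rewrite fE /fam mono_imM low_inl => /andP[Fa _]; apply: hl.
- by move: FQf; rewrite fE /fam mono_imM high_inr => /andP[_ Qb]; apply: hr.
have [Fl Qr] := fam_mixed FQf fP; rewrite -(lpart_rpartK f).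
have FQs : fam F Q (mono_im (mono_sum (lpart f) (rpart f))).
  by rewrite mono_im_sum /fam low_join high_join Fl.
by rewrite nh// nh'// hs.
Qed.
End Unjoin.

Section Mkcoslice.
Variables (n : nat) (Q : pred {set 'I_n.+1}) (h : forall l, mono l (m + n.+1) -> C l).
Hypotheses (nh : natural_on (fam F Q) h).
Hypothesis hp : forall l (x : K l), h (monoM (mono_inl m n) (iota l x)) = p l x.
Variables (l : nat) (y : mono l n).
Hypothesis Qy : Q (mono_im y).

Lemma fam_sum k (x : mono k m) : F (mono_im x) -> fam F Q (mono_im (mono_sum x y)).
Proof.
by move=> Fx; rewrite mono_im_sum /fam low_join high_join Fx.
Qed.

Let c k (x : K k) : C (k + l.+1) := h (mono_sum (iota k x) y).

Lemma mkcoslice_inl k (x : K k) : act (c x) (mono_inl k l) = p k x.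
Proof. by rewrite -nh ?fam_sum// mono_sum_comp_inl hp. Qed.

Lemma mkcoslice_inr k (x : K k) :
  act (c x) (mono_inr k l) = h (monoM (mono_inr m n) y).
Proof. by rewrite -nh ?fam_sum// mono_sum_comp_inr. Qed.

Lemma mkcoslice_act k' k (x : K k) (f : mono k' k) :
  c (act x f) = act (c x) (mono_sum f (mono1 l)).
Proof. by rewrite -nh ?fam_sum// mono_sumM monoM1 /c smap_act. Qed.

(** The other direction of the adjunction: a partial map from the join that restricts to [p],
    evaluated on the joins of all simplices of [K] with [y]. *)
Definition mkcoslice : coslice p l :=
  CosliceSimplex mkcoslice_inl mkcoslice_inr mkcoslice_act.
End Mkcoslice.

Lemma mkcoslice_natural n (Q : pred {set 'I_n.+1}) (h : forall l, mono l (m + n.+1) -> C l)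
    (nh : natural_on (fam F Q) h)
    (hp : forall l (x : K l), h l (monoM (mono_inl m n) (iota l x)) = p l x)
    k l (y : mono l n) (Qy : Q (mono_im y)) (g : mono k l) (Qyg : Q (mono_im (monoM y g))) :
  F set0 -> mkcoslice nh hp Qyg = act (mkcoslice nh hp Qy) g.
Proof.
move=> F0; apply: coslice_simplex_eq => [|r x] /=.
  by rewrite -monoA nh// /fam mono_imM low_inr high_inr F0.
by rewrite -nh ?fam_sum// mono_sumM monoM1.
Qed.

(** [mkcoslice] turns [h] into a sphere in the coslice, initiality of [c] fills it, and [unjoin]
    turns the filler back into a partial map on the join. *)
Lemma initial_coneP (c : coslice p 0) : F set0 -> initial c ->
  initial_cone F (unjoin (fun l f => act c f)).
Proof.
move=> F0 c_init n n0 h nh hk.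
have nc : natural_on predT (fun l (f : mono l 0) => act c f).
  by move=> ? ? ? ? _; rewrite actM.
have im_inl l (x : K l) : fam F predT (mono_im (monoM (mono_inl m 0) (iota l x))).
  by rewrite /fam mono_imM low_inl iotaF.
have hp l (x : K l) : h l (monoM (mono_inl m n) (iota l x)) = p l x.
  rewrite -[in RHS](iotaK x) -(unjoin_inl (fun l f => act c f)) -hk//.
  by rewrite -monoA mono_sum_comp_inl monoM1.
pose b l (y : boundary n l) : coslice p l :=
  mkcoslice nh hp ((in_boundaryP (sval y)).1 (svalP y)).
have bn k l (y : boundary n l) (g : mono k l) : b k (act y g) = act (b l y) g.
  exact: mkcoslice_natural.
have [|x xP] := c_init n n0 (SMap bn).
(* The sphere starts at [c]: this is [hk], read once on the apex and once on the cones. *)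
- move=> [v vP] /= v0; have {}v0 : v = mono_cst 0 ord0.
    by apply: mono_eq => i; rewrite (ord1 i).
  apply: coslice_simplex_eq => [|k x] /=.
    have := hk 0 (monoM (mono_inr m 0) (mono1 0)).
    rewrite unjoin_inr act1 /fam mono_imM low_inr F0 => <-//.
    by rewrite -monoA mono_sum_comp_inr monoM1 v0.
  have := hk _ (mono_sum (iota k x) (mono1 0)).
  rewrite (unjoin_sum nc)// iotaK act1 => <-; last exact: fam_sum.
  by rewrite mono_sumM mono1M monoM1 v0.
have xE l (f : mono l n) (fb : proper_faces (mono_im f)) :
    act x f = mkcoslice nh hp fb.
  rewrite -(xP l (exist _ f ((in_boundaryP f).2 fb))) /= /b /=.
  by congr mkcoslice; apply: Prop_irrelevance.
have nx : natural_on predT (fun l (f : mono l n) => act x f).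
  by move=> ? ? ? ? _; rewrite actM.
exists (unjoin (fun l f => act x f)).
  exact: (unjoin_natural (@down_predT _)).
have nx' : natural_on (fam F (@proper_faces n)) (unjoin (fun l f => act x f)).
  apply: natural_on_sub (unjoin_natural (@down_predT _) nx) => D /andP[FD _].
  by rewrite /fam FD.
apply: (agree_on_fam (@down_proper_faces n) nx' nh) => [l a Fa|l f Qf|r s a f Fa Qf].
- by rewrite unjoin_inl -[in RHS](kappaK Fa) hp.
- by rewrite unjoin_inr (xE _ _ Qf).
- by rewrite (unjoin_sum nx)// (xE _ _ Qf) /= kappaK.
Qed.
End Coordinates.

(** * Squares *)

Lemma mono_of_seq_homo m N (s : seq 'I_N.+1) :
  (size s == m.+1) && sorted leq (map val s) ->
  {homo (fun i : 'I_m.+1 => nth ord0 s i) : i j / (i <= j)%N}.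
Proof.
move=> /andP[/eqP sz ss] i j ij.
rewrite -![nat_of_ord (nth _ _ _)](nth_map _ 0) ?sz ?ltn_ord//.
by apply: (sorted_leq_nth leq_trans leqnn) => //; rewrite inE size_map sz ltn_ord.
Qed.

Definition mono_of_seq m N (s : seq 'I_N.+1) ss : mono m N := Mono (@mono_of_seq_homo m N s ss).

Local Notation v2 j := (@Ordinal 2 j isT).
Local Notation v3 j := (@Ordinal 3 j isT).
Local Notation v4 j := (@Ordinal 4 j isT).
Local Notation v5 j := (@Ordinal 5 j isT).

(** The list holds the forbidden pairs, normally the incomparable ones; a diagonal pair [(v, v)]
    deletes the vertex [v]. *)
Definition flag m (s : seq ('I_m.+1 * 'I_m.+1)) : pred {set 'I_m.+1} :=
  fun D => all (fun e => ~~ ((e.1 \in D) && (e.2 \in D))) s.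

Lemma down_flag m (s : seq ('I_m.+1 * 'I_m.+1)) : down (flag s).
Proof.
move=> A B /subsetP AB /allP sB; apply/allP => e /sB.
by apply: contra => /andP[/AB-> /AB->].
Qed.

Lemma flag0 m (s : seq ('I_m.+1 * 'I_m.+1)) : flag s set0.
Proof. by apply/allP => e _; rewrite inE. Qed.

Definition span_flag : pred {set 'I_3} := flag [:: (v3 1, v3 2)].

Lemma in_span_flag l (f : mono l 2) :
  span_flag (mono_im f) -> v3 2 \in mono_im f -> forall i, f i != v3 1.
Proof.
rewrite /span_flag /flag /= andbT => /negP f12 f2 i; apply/negP => /eqP fi; apply: f12.
by rewrite f2 andbT -fi mem_mono_im.
Qed.

(** The vertex [(a, b)] of the square gets the number a + 2b, a linear extension of its order. The
    span occupies 0, 1, 2 with 1 and 2 incomparable, and [(1, 1)] is the last vertex 3, so that the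
    square is the join of the span with a point. *)
Lemma square_code_bound (a b : 'I_2) : (a + b.*2 < 4)%N.
Proof. by case: a b => [[|[|a]] // _] [[|[|b]] // _]. Qed.

Lemma square_code_homo l (x : Square l) :
  {homo (fun i => Ordinal (square_code_bound (x.1 i) (x.2 i))) : i j / (i <= j)%N}.
Proof. by move=> i j ij; rewrite /= leq_add ?leq_double ?mono_le. Qed.

Lemma square_code_act k l (x : Square l) (f : mono k l) :
  Mono (square_code_homo (act x f)) = act (Mono (square_code_homo x) : Delta 3 l) f.
Proof. by apply: mono_eq => i; apply: val_inj. Qed.

Definition square_code : smap Square (Delta 3) :=
  @SMap Square (Delta 3) (fun l x => Mono (square_code_homo x)) square_code_act.

Lemma square_codeE l (x : Square l) i : square_code l x i = (x.1 i + (x.2 i).*2)%N :> nat.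
Proof. by []. Qed.

Lemma square_code_flag l (x : Square l) :
  span_flag (low (m := 2) (n := 0) (mono_im (square_code l x))).
Proof.
rewrite /span_flag /flag /= andbT !inE.
apply/negP => /andP[/mono_imP[i fi] /mono_imP[j fj]].
have := congr1 val fi; have := congr1 val fj; rewrite /=.
have [ij|/ltnW ji] := leqP i j.
  have := mono_le x.1 ij; move: (x.1 i) (x.2 i) (x.1 j) (x.2 j).
  by do 4![case=> [[|[|?]] ? //]].
have := mono_le x.2 ji; move: (x.1 i) (x.2 i) (x.1 j) (x.2 j).
by do 4![case=> [[|[|?]] ? //]].
Qed.

Lemma span_code_act k l (x : Span l) (f : mono k l) :
  monoM (lretr 2 0) (square_code k (sval (act x f))) =
  act (monoM (lretr 2 0) (square_code l (sval x)) : Delta 2 l) f.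
Proof. by rewrite -[RHS]/(monoM _ _) monoA; congr monoM; rewrite /= square_code_act. Qed.

Definition span_code : smap Span (Delta 2) :=
  @SMap Span (Delta 2) (fun l x => monoM (lretr 2 0) (square_code l (sval x))) span_code_act.

Lemma inl_span_code l (x : Span l) :
  monoM (mono_inl 2 0) (span_code l x) = square_code l (sval x).
Proof.
apply: mono_eq => i.
rewrite monoMx -[span_code l x]/(monoM (lretr 2 0) _) monoMx inl_lretr// square_codeE.
have := svalP x i; move: ((sval x).1 i) ((sval x).2 i).
by case=> [[|[|a]] // ?] [[|[|b]] // ?].
Qed.

Lemma span_codeE l (x : Span l) i :
  span_code l x i = ((sval x).1 i + ((sval x).2 i).*2)%N :> nat.
Proof.
rewrite -square_codeE -inl_span_code monoMx.
by [].
Qed.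

Lemma span_code_flag l (x : Span l) : span_flag (mono_im (span_code l x)).
Proof.
by rewrite -[mono_im _](@low_inl 2 0) -mono_imM inl_span_code square_code_flag.
Qed.

Lemma in_span_l l (a : mono l 1) : in_span ((a, mono_cst l ord0) : Square l).
Proof. by move=> i; rewrite /= andbF. Qed.

Lemma in_span_r l (b : mono l 1) : in_span ((mono_cst l ord0, b) : Square l).
Proof. by move=> i. Qed.

Definition leg1 : mono 2 1 := @mono_of_seq 2 1 [:: v2 0; v2 1; v2 1] isT.
Definition leg2 : mono 2 1 := @mono_of_seq 2 1 [:: v2 0; v2 0; v2 1] isT.

(** A simplex of the span lies on one of its two edges, and meeting the vertex 2 decides which. The
    simplices constant at 0 lie on both and are decoded on the edge to 1. *)
Definition span_decode l (f : mono l 2) : Span l :=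
  if v3 2 \in mono_im f then exist _ _ (in_span_r (monoM leg2 f))
  else exist _ _ (in_span_l (monoM leg1 f)).

Lemma span_decode_natural : natural_on span_flag span_decode.
Proof.
move=> k l f g Ff; rewrite /span_decode.
have [f2|f2] := boolP (v3 2 \in mono_im f); last first.
  rewrite ifN; last by apply: contra f2; apply/subsetP/mono_imMS.
  by apply: eq_exist; congr pair; apply: mono_eq.
have f1 := in_span_flag Ff f2; case: ifP => fg; apply: eq_exist.
  by congr pair; apply: mono_eq.
(* Here the face has shrunk to the vertex 0 and changes edge under decoding; both edges give the
   same constant simplex. *)
have fg0 i : f (g i) = v3 0.
  have := f1 (g i); have : f (g i) != v3 2.
    apply: contraFneq fg => <-; exact: (mem_mono_im (monoM f g)).
  by case: (f (g i)) => [[|[|[|?]]] ?] // _ _; apply: val_inj.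
by congr pair; apply: mono_eq => i; rewrite !monoMx fg0; apply: val_inj.
Qed.

Lemma span_codeK l (f : mono l 2) : span_flag (mono_im f) -> span_code l (span_decode f) = f.
Proof.
move=> Ff; apply: mono_eq => i; apply: val_inj; rewrite /= span_codeE /span_decode.
case: ifPn => f2 /=.
  by have := in_span_flag Ff f2 i; case: (f i) => [[|[|[|?]]] ?].
have : f i != v3 2 by apply: contraNneq f2 => <-; apply: mem_mono_im.
by case: (f i) => [[|[|[|?]]] ?].
Qed.

Lemma span_decodeK l (x : Span l) : span_decode (span_code l x) = x.
Proof.
case: x => [[a b] xP]; rewrite /span_decode.
set y := exist _ _ xP.
case: ifPn => f2; apply: eq_exist; congr pair; apply: mono_eq => i; apply: val_inj;
  have cE := span_codeE y i.
- have := in_span_flag (span_code_flag y) f2 i; move: (span_code l y i) cE => c.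
  by move=> /=; move: (xP i) => /=; case: (a i) => [[|[|?]] ?] //; case: (b i) => [[|[|?]] ?] //;
    case: c => [[|[|[|?]]] ?].
- have := in_span_flag (span_code_flag y) f2 i; rewrite monoMx.
  move: (span_code l y i) cE => c.
  by move=> /=; move: (xP i) => /=; case: (a i) => [[|[|?]] ?] //; case: (b i) => [[|[|?]] ?] //;
    case: c => [[|[|[|?]]] ?].
- have : span_code l y i != v3 2 by apply: contraNneq f2 => <-; apply: mem_mono_im.
  rewrite monoMx; move: (span_code l y i) cE => c.
  by move=> /=; move: (xP i) => /=; case: (a i) => [[|[|?]] ?] //; case: (b i) => [[|[|?]] ?] //;
    case: c => [[|[|[|?]]] ?].
- have : span_code l y i != v3 2 by apply: contraNneq f2 => <-; apply: mem_mono_im.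
  move: (span_code l y i) cE => c.
  by move=> /=; move: (xP i) => /=; case: (a i) => [[|[|?]] ?] //; case: (b i) => [[|[|?]] ?] //;
    case: c => [[|[|[|?]]] ?].
Qed.

Section SquareOf.
Variables (C : sset) (k : forall l, mono l (2 + 1) -> C l).
Hypothesis nk : natural_on (fam span_flag predT) k.

Lemma square_of_act k' l (x : Square l) (f : mono k' l) :
  k (square_code k' (act x f)) = act (k (square_code l x)) f.
Proof. by rewrite smap_act /= nk// /fam square_code_flag. Qed.

Definition square_of : smap Square C :=
  @SMap Square C (fun l x => k (square_code l x)) square_of_act.

Lemma corner_square_of (a b : 'I_2) (j : 'I_4) : (a + b.*2 = j)%N ->
  corner square_of a b = k (mono_cst 0 j).
Proof.
by move=> abj; congr k; apply: mono_eq => i; apply: val_inj; exact: abj.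
Qed.

Lemma snoc_square_code l (x : Span l) :
  square_code (l + 1) (snoc_max (sval x).1, snoc_max (sval x).2) =
  mono_sum (span_code l x) (mono1 0).
Proof.
apply: mono_eq => i; apply: val_inj; rewrite [val _]square_codeE.
have [[a ->]|[b ->]] := join_ordP i.
  rewrite mono_sumL [RHS]span_codeE.
  by rewrite (snoc_max_inl (sval x).1 a) (snoc_max_inl (sval x).2 a).
rewrite mono_sumR (snoc_max_inr (sval x).1 b) (snoc_max_inr (sval x).2 b).
by rewrite mono1E (ord1 b).
Qed.

(** The converse of [initial_coneP] for spans: [unjoin] carries a sphere in the coslice to the join,
    [k_init] extends it, and [mkcoslice] at the top simplex reads off the filler. *)
Lemma initial_cone_pushout : initial_cone span_flag k -> pushout square_of.
Proof.
move=> k_init n n0 b bv.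
(* The sphere has values on the boundary alone; elsewhere [beta] takes a default, and [nbeta]
   asserts naturality on proper faces. *)
pose beta l (f : mono l n) : coslice (span_of square_of) l :=
  if pselect (in_boundary f) is left fb then b l (exist _ f fb)
  else act (square_cone square_of) (mono_cst l ord0).
have betaE l (f : mono l n) (fb : in_boundary f) : beta l f = b l (exist _ f fb).
  rewrite /beta; case: pselect => // fb'; congr (b l (exist _ f _)).
  exact: Prop_irrelevance.
have nbeta : natural_on (@proper_faces n) beta.
  move=> r l f g /in_boundaryP fb; rewrite (betaE _ _ fb).
  rewrite (betaE _ _ (in_boundary_act g fb)) -smap_act; congr (b r _).
  exact: eq_exist.
have proper0 l : proper_faces (mono_im (mono_cst l (ord0 : 'I_n.+1))).
  rewrite mono_im_cst /=; apply/negP => /eqP /setP/(_ ord_max).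
  by rewrite !inE -val_eqE /= => /eqP n1; rewrite n1 in n0.
have beta0 l : beta l (mono_cst l ord0) = act (square_cone square_of) (mono_cst l ord0).
  have e : mono_cst l (ord0 : 'I_n.+1) = monoM (mono_cst 0 ord0) (mono_cst l ord0).
    exact: mono_eq.
  rewrite {1}e nbeta; last exact: proper0.
  have /in_boundaryP fb := proper0 0; rewrite (betaE _ _ fb).
  by rewrite bv.
have dspan : down span_flag by exact: down_flag.
have proper_down := @down_proper_faces n.
have nh := unjoin_natural dspan span_decode_natural proper_down nbeta.
have [] := k_init n n0 _ nh.
  have cst0 l (f : mono l 0) : monoM (mono_cst 0 (ord0 : 'I_n.+1)) f = mono_cst l ord0.
    exact: mono_eq.
  apply: (agree_on_fam (m := 2) dspan (@down_predT _)).
  - apply: natural_on_comp nh => D /andP[FD _].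
    rewrite /fam low_sum high_sum; apply/andP; split.
      by apply: dspan FD; apply/subsetP => _ /imsetP[x xD ->].
    apply: proper_down (proper0 0); apply/subsetP => _ /imsetP[x _ ->].
    by rewrite mono_im_cst inE.
  - exact: nk.
  - move=> l a Fa; rewrite -monoA mono_sum_comp_inl monoA mono1M unjoin_inl.
    by rewrite -[in RHS](span_codeK Fa) inl_span_code.
  - move=> l c _; rewrite -monoA mono_sum_comp_inr monoA unjoin_inr cst0 beta0.
    rewrite -[LHS]/(act (k (square_code 0 (vertex ord_max ord_max))) (mono_cst l ord0)).
    rewrite -nk; last by rewrite /fam square_code_flag.
    congr k; apply: mono_eq => i; apply: val_inj => /=.
    by rewrite (ord1 (c i)).
  - move=> r s a c Fa _; rewrite mono_sumM mono1M cst0.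
    rewrite (unjoin_sum span_decode_natural nbeta)//.
    rewrite beta0 -[LHS]/(act (k (square_code (r + 1) (_, _))) (mono_sum (mono1 r) _)).
    rewrite -nk; last by rewrite /fam square_code_flag.
    congr k; rewrite snoc_square_code mono_sumM mono1M span_codeK//.
    rewrite monoM1; congr mono_sum; apply: mono_eq => i.
    by rewrite (ord1 (c i)); apply: val_inj.
move=> h' nh' h'E.
have inl_fam l (x : Span l) : fam span_flag (@proper_faces n)
    (mono_im (monoM (mono_inl 2 n) (span_code l x))).
  rewrite /fam mono_imM low_inl high_inl span_code_flag /=.
  by apply/negP => /eqP /setP/(_ ord0); rewrite !inE.
have hp l (x : Span l) :
    h' l (monoM (mono_inl 2 n) (span_code l x)) = span_of square_of l x.
  by rewrite h'E// unjoin_inl span_decodeK.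
exists (mkcoslice span_code_flag nh' hp (y := mono1 n) isT) => l [y yP].
have /in_boundaryP yb := yP.
rewrite /= -betaE; apply: coslice_simplex_eq => [|r x] /=.
  rewrite -nh'; last by rewrite /fam mono_imM low_inr [span_flag _]flag0.
  by rewrite monoM1 h'E ?unjoin_inr// /fam mono_imM low_inr high_inr [span_flag _]flag0.
rewrite -nh'; last by rewrite fam_sum// span_code_flag.
rewrite mono_sumM monoM1 mono1M h'E; last by rewrite fam_sum// span_code_flag.
rewrite (unjoin_sum span_decode_natural nbeta) ?span_decodeK//.
exact: span_code_flag.
Qed.
End SquareOf.

(** * Pasting *)

(** The nerve of the poset generated by [0 < 1 < 3] and [0 < 2 < 3] and [2 < 4],
    the pairs being those of incomparable elements. In the two rows [0, 2, 4] and
    [1, 3] of a composite of squares the last vertex of the second row is missing: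
    it is the apex of cones under [rect]. *)
Definition rect : pred {set 'I_5} := flag [:: (v5 1, v5 2); (v5 1, v5 4); (v5 3, v5 4)].
Definition rect_no3 : pred {set 'I_5} := flag [:: (v5 3, v5 3); (v5 1, v5 2); (v5 1, v5 4)].
(** The span 3 <- 2 -> 4 of the second square; [outer_span] is the span 1 <- 0 -> 4 of the
    composite. *)
Definition rect_span : pred {set 'I_5} := flag [:: (v5 0, v5 0); (v5 1, v5 1); (v5 3, v5 4)].
Definition outer_span : pred {set 'I_5} := flag [:: (v5 2, v5 2); (v5 3, v5 3); (v5 1, v5 4)].

Lemma rectE (D : {set 'I_5}) : rect D = [&& ~~ ((v5 1 \in D) && (v5 2 \in D)),
  ~~ ((v5 1 \in D) && (v5 4 \in D)) & ~~ ((v5 3 \in D) && (v5 4 \in D))].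
Proof. by rewrite /rect /flag /= andbT. Qed.

(** Families of subsets of the five objects are encoded by predicates on their
    characteristic sequences, on which conditions on cells are decided. *)
Definition bits (D : {set 'I_5}) : seq bool := [seq i \in D | i <- enum 'I_5].

Definition all_bits : seq (seq bool) :=
  foldr (fun _ t => [seq true :: b | b <- t] ++ [seq false :: b | b <- t]) [:: [::]] (iota 0 5).

Section Codes.
Implicit Types (D : {set 'I_5}) (c : pred (seq bool)).

Lemma size_bits D : size (bits D) = 5.
Proof. by rewrite size_map size_enum_ord. Qed.

Lemma nth_bits D (i : 'I_5) : nth false (bits D) i = (i \in D).
Proof. by rewrite (nth_map i) ?size_enum_ord// nth_ord_enum. Qed.

Lemma mem_all_bits D : bits D \in all_bits.
Proof.
have := size_bits D; case: (bits D) => [|? [|? [|? [|? [|? [|? ?]]]]]] // _.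
by do 5![match goal with b : bool |- _ => case: b end].
Qed.

Definition set_of_bits (a : seq bool) : {set 'I_5} := [set i : 'I_5 | nth false a i].

Lemma eq_set_of_bits D a : size a = 5 -> (D == set_of_bits a) = (bits D == a).
Proof.
move=> a5; apply/eqP/eqP => [->|<-].
  apply: (@eq_from_nth _ false) => [|i]; rewrite size_bits ?a5// => i5.
  by rewrite (nth_bits _ (Ordinal i5)) inE.
by apply/setP => i; rewrite inE nth_bits.
Qed.

Lemma sub_set_of_bits D a : size a = 5 -> D \subset set_of_bits a ->
  all2 implb (bits D) a.
Proof.
move=> a5 /subsetP Da; rewrite all2E size_bits a5 /=.
apply/(all_nthP (false, false)) => i; rewrite size_zip size_bits a5 => i5.
rewrite nth_zip ?size_bits ?a5//= (nth_bits _ (Ordinal i5)).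
by apply/implyP => /Da; rewrite inE.
Qed.

Definition coded (c : pred (seq bool)) : pred {set 'I_5} := fun D => c (bits D).

Definition flag_code (s : seq ('I_5 * 'I_5)) : pred (seq bool) :=
  fun b => all (fun e : 'I_5 * 'I_5 => ~~ (nth false b e.1 && nth false b e.2)) s.

Lemma flag_coded (s : seq ('I_5 * 'I_5)) : flag s = coded (flag_code s).
Proof. by apply/funext => D; apply: eq_all => e; rewrite /= !nth_bits. Qed.

Lemma eq_coded c c' : all (fun b => c b == c' b) all_bits -> coded c = coded c'.
Proof. by move=> /allP cc; apply/funext => D; apply/eqP/cc/mem_all_bits. Qed.

Definition facet (x : seq bool * nat) : seq bool := set_nth false x.1 x.2 false.

Definition add_code (c : pred (seq bool)) (x : seq bool * nat) : pred (seq bool) :=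
  fun b => [|| c b, b == x.1 | b == facet x].

(** The hypotheses of [extendable_cell] in decidable form: the [has] clause finds the earlier vertex
    [u], and the last clause checks on all 32 subsets that only the cell and its facet are
    missing. *)
Definition cell_ok (c : pred (seq bool)) (x : seq bool * nat) :=
  [&& size x.1 == 5, (x.2 < 5)%N, nth false x.1 x.2,
      has (fun u => nth false x.1 u) (iota 0 x.2) &
      all (fun b => all2 implb b x.1 ==> (c b == (b != x.1) && (b != facet x))) all_bits].

Fixpoint cells_ok (c : pred (seq bool)) (s : seq (seq bool * nat)) :=
  if s is x :: s' then cell_ok c x && cells_ok (add_code c x) s' else true.

Lemma cell_okP c a v (v5 : (v < 5)%N) : cell_ok c (a, v) ->
  let A := set_of_bits a in let vo := Ordinal v5 in
  [/\ vo \in A, exists2 u : 'I_5, u \in A & (u < v)%N,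
      add_cell (coded c) A vo = coded (add_code c (a, v)) &
      forall D, D \subset A -> coded c D = (D != A) && (D != A :\ vo)].
Proof.
move=> /and5P[/eqP a5 _ av /hasP[u + au] /allP ca] A vo.
rewrite mem_iota /= add0n => uv; have u5 := ltn_trans uv v5.
have facetE : set_of_bits (facet (a, v)) = A :\ vo.
  by apply/setP => i; rewrite !inE nth_set_nth /= -val_eqE /=; case: eqP.
have facet5 : size (facet (a, v)) = 5.
  by rewrite /facet size_set_nth /= a5 (maxn_idPr _).
split; first by rewrite inE.
- by exists (Ordinal u5); rewrite ?inE.
- by apply/funext => D; rewrite /add_cell -facetE !eq_set_of_bits.
move=> D DA; rewrite -facetE !eq_set_of_bits//; apply/eqP.
by move/implyP: (ca _ (mem_all_bits D)); apply; apply: sub_set_of_bits.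
Qed.

Lemma extendable_code C k c x : quasicategory C -> down (coded c) -> cell_ok c x ->
  down (coded (add_code c x)) /\ @extendable C 4 k (coded c) (coded (add_code c x)).
Proof.
case: x => a v qC dc ca; have v5 : (v < 5)%N by case/and5P: ca.
have [vA [u uA uv] <- FA] := cell_okP v5 ca.
by split; [apply: down_add_cell|apply: (extendable_cell (u := u))].
Qed.

Lemma extendable_codes C k c s : quasicategory C -> down (coded c) -> cells_ok c s ->
  down (coded (foldl add_code c s)) /\
  @extendable C 4 k (coded c) (coded (foldl add_code c s)).
Proof.
move=> qC; suff H : down (coded c) -> cells_ok c s ->
    [/\ down (coded (foldl add_code c s)),
        forall D, coded c D -> coded (foldl add_code c s) D &
        @extendable C 4 k (coded c) (coded (foldl add_code c s))].
  by move=> /H{}H /H[].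
elim: s c => [|x s IH] c dc /=.
  move=> _; split=> // n G G' dG dG' _ GG' h nh _; exists h => //.
  by apply: natural_on_sub nh => D /= ->.
case/andP => cx cs; have [dx ex] := extendable_code k qC dc cx.
have [df sf ef] := IH _ dx cs; split=> //.
  by move=> D cD; apply: sf; rewrite /coded /add_code -/(coded c D) cD.
apply: (extendable_trans dc dx df) => // D cD.
by rewrite /coded /add_code -/(coded c D) cD.
Qed.

(** A right anodyne inclusion is verified by computation from the list [s] of horns to be filled in
    order; a cell is written as a row of digits, followed by the vertex of its horn. *)
Lemma extendable_flags C k (t t' : seq ('I_5 * 'I_5)) (s : seq (seq nat * nat)) :
  let s' := [seq (map (leq 1) x.1, x.2) | x <- s] in
  quasicategory C -> cells_ok (flag_code t) s' ->
  all (fun b => flag_code t' b == foldl add_code (flag_code t) s' b) all_bits ->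
  @extendable C 4 k (flag t) (flag t').
Proof.
move=> s' qC ts /eq_coded; rewrite !flag_coded => ->.
by have [|] := extendable_codes k qC _ ts; first by rewrite -flag_coded; apply: down_flag.
Qed.

End Codes.

Lemma extendable_rect_span C k : quasicategory C -> @extendable C 4 k rect_span rect.
Proof.
(* Attach 0 below 2 and compose to 0 -> 3 and 0 -> 4; attach 1 below 3; the right horn 0 -> 3 <- 1
   then yields the edge 0 -> 1. *)
pose s := [:: ([:: 1; 0; 1; 0; 0], 2); ([:: 1; 0; 1; 1; 0], 2); ([:: 1; 0; 1; 0; 1], 2);
  ([:: 0; 1; 0; 1; 0], 3); ([:: 1; 1; 0; 1; 0], 3)].
by move=> qC; apply: (extendable_flags (s := s)).
Qed.

Lemma extendable_outer_span C k : quasicategory C -> @extendable C 4 k outer_span rect_no3.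
Proof.
(* Attach 2 below 4; the right horn 0 -> 4 <- 2 yields the edge 0 -> 2. *)
pose s := [:: ([:: 0; 0; 1; 0; 1], 4); ([:: 1; 0; 1; 0; 1], 4)].
by move=> qC; apply: (extendable_flags (s := s)).
Qed.

Lemma fam_span_flag (D : {set 'I_4}) :
  fam (m := 2) (n := 0) span_flag predT D = ~~ ((v4 1 \in D) && (v4 2 \in D)).
Proof.
rewrite /fam andbT /span_flag /flag /= andbT !inE.
rewrite (_ : mono_inl 2 0 (v3 1) = v4 1); last exact: val_inj.
by rewrite (_ : mono_inl 2 0 (v3 2) = v4 2); last exact: val_inj.
Qed.

Lemma initial_cone_agree (C : sset) m F (k k' : forall l, mono l (m + 1) -> C l) :
  agree_on (fam F predT) k k' -> initial_cone F k -> initial_cone F k'.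
Proof.
move=> kk' ik n n0 h nh hk; apply: ik nh _ => // l f Ff.
by rewrite kk'// -hk.
Qed.

Definition square_in_rect : mono 3 4 := @mono_of_seq 3 4 [:: v5 0; v5 1; v5 2; v5 3] isT.
Definition rect_to_square : mono 4 3 := @mono_of_seq 4 3 [:: v4 0; v4 1; v4 2; v4 3; v4 3] isT.

Lemma ord3 (i : 'I_3) : [\/ i = v3 0, i = v3 1 | i = v3 2].
Proof.
case: i => [[|[|[|?]]] ?] //.
- by constructor 1; apply: val_inj.
- by constructor 2; apply: val_inj.
- by constructor 3; apply: val_inj.
Qed.

Lemma ord4 (i : 'I_4) : [\/ i = v4 0, i = v4 1, i = v4 2 | i = v4 3].
Proof.
case: i => [[|[|[|[|?]]]] ?] //.
- by constructor 1; apply: val_inj.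
- by constructor 2; apply: val_inj.
- by constructor 3; apply: val_inj.
- by constructor 4; apply: val_inj.
Qed.

Lemma ord5 (i : 'I_5) : [\/ i = v5 0, i = v5 1, i = v5 2 | i = v5 3 \/ i = v5 4].
Proof.
case: i => [[|[|[|[|[|?]]]]] ?] //.
- by constructor 1; apply: val_inj.
- by constructor 2; apply: val_inj.
- by constructor 3; apply: val_inj.
- by constructor 4; left; apply: val_inj.
- by constructor 4; right; apply: val_inj.
Qed.

Lemma square_in_rectK : monoM rect_to_square square_in_rect = mono1 3.
Proof. by apply: mono_eq => i; case: (ord4 i) => ->; apply: val_inj. Qed.

Lemma mem_square_in_rect (E : {set 'I_4}) :
  [/\ (v5 0 \in square_in_rect @: E) = (v4 0 \in E),
      (v5 1 \in square_in_rect @: E) = (v4 1 \in E),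
      (v5 2 \in square_in_rect @: E) = (v4 2 \in E) &
      (v5 3 \in square_in_rect @: E) = (v4 3 \in E) /\
      (v5 4 \in square_in_rect @: E) = false].
Proof.
have sI : injective square_in_rect by exact: can_inj (monoKL square_in_rectK).
have sE i j : square_in_rect i = j -> (j \in square_in_rect @: E) = (i \in E).
  by move=> <-; rewrite mem_imset.
split; try by apply: sE; apply: val_inj.
split; first by apply: sE; apply: val_inj.
by apply/imsetP => -[i _]; case: (ord4 i) => ->.
Qed.

Lemma mem_rect_square (E : {set 'I_4}) :
  rect (square_in_rect @: E) = ~~ ((v4 1 \in E) && (v4 2 \in E)).
Proof.
have [e0 e1 e2 [e3 e4]] := mem_square_in_rect E.
by rewrite /rect /flag /= e1 e2 e3 e4 !andbF !andbT.
Qed.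

Lemma mem_rect_no3_square (E : {set 'I_4}) :
  rect_no3 (square_in_rect @: E) =
  (v4 3 \notin E) && ~~ ((v4 1 \in E) && (v4 2 \in E)).
Proof.
have [e0 e1 e2 [e3 e4]] := mem_square_in_rect E.
by rewrite /rect_no3 /flag /= e1 e2 e3 e4 !andbF !andbT andbb.
Qed.

Section ShiftJoin.
Variables (r : nat) (D : {set 'I_(3 + r.+1).+1}).

(** The joins of [Delta 3] with [Delta r] and of [Delta 2] with [Delta r.+1] are the same simplex:
    the corner 3 of the square becomes vertex 0 of the second factor. This lemma and the next
    translate families between the two readings. *)
Lemma span_flag_shift : span_flag (low (m := 2) (n := r.+1) D) =
  ~~ ((v4 1 \in low (m := 3) (n := r) D) && (v4 2 \in low (m := 3) (n := r) D)).
Proof.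
rewrite /span_flag /flag /= andbT !inE.
by congr (~~ ((_ \in D) && (_ \in D))); apply: val_inj.
Qed.

Lemma high_shift : (high (m := 2) (n := r.+1) D == setT) =
  (v4 3 \in low (m := 3) (n := r) D) && (high (m := 3) (n := r) D == setT).
Proof.
have e0 : mono_inr 2 r.+1 ord0 = mono_inl 3 r (v4 3) by apply: val_inj.
have eS (i : 'I_r.+1) : mono_inr 2 r.+1 (fintype.lift ord0 i) = mono_inr 3 r i.
  by apply: val_inj; rewrite /= /bump.
apply/eqP/andP => [/setP hT|[v3D /eqP/setP hT]].
  split; first by have := hT ord0; rewrite !inE e0.
  by apply/eqP/setP => i; have := hT (fintype.lift ord0 i); rewrite !inE eS.
apply/setP => i; rewrite !inE; have [j ->|->] := unliftP ord0 i.
  by have := hT j; rewrite eS !inE.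
by rewrite e0; move: v3D; rewrite inE.
Qed.
End ShiftJoin.

(** A set of [rect] containing 3 omits 4, so the new simplices lie in the join of the square 0123
    with the simplex on [B]. Read as the join of the span with [Delta r.+1], whose vertex 0 is the
    corner 3, the part already known is the span joined with the boundary, and at vertex 0 it is the
    initial cone. Initiality fills it. *)
Lemma extendable_rect_no3 (C : sset) (k : forall l, mono l 4 -> C l) :
  initial_cone span_flag (fun l (f : mono l (2 + 1)) => k l (monoM square_in_rect f)) ->
  extendable k rect_no3 rect.
Proof.
move=> ik; have dr : down rect by exact: down_flag.
have dn : down rect_no3 by exact: down_flag.
have rect_or D : rect D -> v5 3 \notin D -> rect_no3 D.
  by rewrite /rect /rect_no3 /flag /= !andbT andbb => /and3P[-> -> _] ->.
apply: extendable_step => // n G G' B dG dG' G0 G'B nGB GB h nh kh.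
have [r [s [s' [s'K sB]]]] : exists r (s : mono r n) (s' : mono n r),
    monoM s' s = mono1 r /\ mono_im s = B.
  by apply: mono_enum; apply: contraNneq nGB => ->.
have sE (E : {set 'I_r.+1}) : s @: E \subset B.
  by apply/subsetP => _ /imsetP[i _ ->]; rewrite -sB mem_mono_im.
have sT (E : {set 'I_r.+1}) : (s @: E == B) = (E == setT).
  have -> : B = s @: setT.
    by rewrite -sB; apply/setP => j; apply/mono_imP/imsetP => [[i <-]|[i _ ->]]; exists i.
  apply/eqP/eqP => [|->//]; exact: (imset_inj (can_inj (monoKL s'K))).
pose S : mono (3 + r.+1) (4 + n.+1) := mono_sum square_in_rect s.
pose S' : mono (4 + n.+1) (3 + r.+1) := mono_sum rect_to_square s'.
have S'K : monoM S' S = mono1 _ by rewrite mono_sumM square_in_rectK s'K mono_sum1.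
set P : pred {set 'I_(4 + n.+1).+1} := predU (fam rect_no3 G') (fam rect G).
have dP : down P by apply: down_or; apply: down_fam.
have PS (D : {set 'I_(3 + r.+1).+1}) : P (S @: D) =
    fam (m := 2) (n := r.+1) span_flag (@proper_faces _) D.
  rewrite /P /= /fam low_sum high_sum mem_rect_square mem_rect_no3_square.
  rewrite span_flag_shift /= high_shift.
  case: (v4 3 \in _) => /=; last first.
    by rewrite (dG' _ _ (sE _) G'B) andbT; case: (v4 1 \in _); case: (v4 2 \in _).
  rewrite -sT; congr (_ && _); have [->|nB] := eqVneq (s @: _) B.
    exact: negbTE.
  by rewrite GB// properEneq nB sE.
have [||h1 nh1 h1h] := ik r.+1 isT (fun l f => h l (monoM S f)).
- by apply: natural_on_comp nh => D QD; apply: etrans (PS D) QD.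
- move=> l f Ff; rewrite -monoA.
  have -> : monoM S (mono_sum (mono1 2) (mono_cst 0 ord0)) =
      monoM (mono_inl 4 n) square_in_rect.
    apply: mono_eq => i; have [[a ->]|[b ->]] := @join_ordP 2 0 i.
      rewrite [LHS]monoMx mono_sumL.
      have -> : mono_inl 2 r.+1 (mono1 2 a) = mono_inl 3 r (mono_inl 2 0 a) by apply: val_inj.
      by rewrite [LHS]mono_sumL.
    rewrite [LHS]monoMx mono_sumR (ord1 b).
    have -> : mono_inr 2 r.+1 (mono_cst 0 ord0 ord0) = mono_inl 3 r (mono_inr 2 0 ord0).
      exact: val_inj.
    by rewrite [LHS]mono_sumL.
  by rewrite monoA; apply: kh; rewrite mono_imM mem_rect_square -fam_span_flag.
apply: (extend_along (s := S) (r := S') (k := h1)) => //.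
- move=> D /= P'D; rewrite negb_or => /andP[n1 n2].
  rewrite [mono_im S]mono_im_sum joinS sB; move: P'D n1 n2; rewrite /fam.
  case/orP => /andP[lD /=]; first by move=> ->; rewrite lD.
  rewrite lD => /orP[->//|/eqP hD]; rewrite hD G'B subxx !andbT => n1 _.
  have v3D : v5 3 \in low D by apply: contraR n1; apply: rect_or.
  apply/subsetP => i iD; case: (ord5 i) iD => [->|->|->|[->|->]] iD.
  + by apply/mono_imP; exists (v4 0); apply: val_inj.
  + by apply/mono_imP; exists (v4 1); apply: val_inj.
  + by apply/mono_imP; exists (v4 2); apply: val_inj.
  + by apply/mono_imP; exists (v4 3); apply: val_inj.
  + by move: lD; rewrite /rect /flag /= v3D iD !andbF.
- apply: natural_on_sub nh1 => D /=; rewrite /fam low_sum mem_rect_square.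
  rewrite mem_rect_no3_square andbT span_flag_shift.
  by case/orP => /andP[] => [/andP[]|].
- by move=> l f Pf; apply: h1h; apply: etrans (esym (PS _)) Pf.
Qed.

Lemma fam_sum_im m n m' n' (s : mono m' m) (t : mono n' n) (F : pred {set 'I_m.+1})
    (G : pred {set 'I_n.+1}) (D : {set 'I_(m' + n'.+1).+1}) :
  fam F G (mono_sum s t @: D) = F (s @: low D) && G (t @: high D).
Proof. by rewrite /fam low_sum high_sum. Qed.

Lemma mono1_im n (B : {set 'I_n.+1}) : mono1 n @: B = B.
Proof. by rewrite -[RHS]imset_id; apply: eq_imset. Qed.

Lemma sum_comp_low m m' n n' l (s : mono m' m) (r : mono m m') (t : mono n n')
    (f : mono l (m + n.+1)) : monoM r s = mono1 m' -> low (mono_im f) \subset mono_im s ->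
  monoM (mono_sum (monoM s r) t) f = monoM (mono_sum (mono1 m) t) f.
Proof.
move=> rs /subsetP fs; apply: mono_eq => i; rewrite !monoMx.
have [[a fi]|[b ->]] := join_ordP (f i); last by rewrite !mono_sumR.
have /mono_imP[x xa] : a \in mono_im s by apply: fs; rewrite inE -fi mem_mono_im.
by rewrite fi !mono_sumL monoMx -xa (monoKL rs).
Qed.

Lemma sum_comp_high m m' n n' l (s : mono m m') (t t' : mono n n')
    (f : mono l (m + n.+1)) : {in high (mono_im f), t =1 t'} ->
  monoM (mono_sum s t) f = monoM (mono_sum s t') f.
Proof.
move=> tt'; apply: mono_eq => i; rewrite !monoMx.
have [[a ->]|[b fi]] := join_ordP (f i); first by rewrite !mono_sumL.
by rewrite fi !mono_sumR tt'// inE -fi mem_mono_im.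
Qed.

Lemma imset_retrK m m' (s : mono m m') (r : mono m' m) (D : {set 'I_m'.+1}) :
  monoM r s = mono1 m -> D \subset mono_im s -> s @: (r @: D) = D.
Proof.
move=> rs /subsetP Ds; rewrite -imset_comp -[RHS]imset_id; apply: eq_in_imset => i /Ds.
by case/mono_imP => j <-; rewrite /= (monoKL rs).
Qed.

Section Transfer.
Variables (C : sset) (k : forall l, mono l 4 -> C l).
Variables (hK : forall l, mono l (4 + 1) -> C l).
Hypotheses (nhK : natural_on (fam rect predT) hK) (kK : restricts k rect hK).
Variables (s1 s2 : mono 2 4) (r1 r2 : mono 4 2) (F1 F2 : pred {set 'I_5}).
Hypotheses (s1K : monoM r1 s1 = mono1 2) (s2K : monoM r2 s2 = mono1 2).
Hypotheses (s1F : forall E : {set 'I_3}, rect (s1 @: E) = span_flag E)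
  (s2F : forall E : {set 'I_3}, rect (s2 @: E) = span_flag E).
Hypotheses (F1E : forall D, F1 D = (D \subset mono_im s1) && rect D)
  (F2E : forall D, F2 D = (D \subset mono_im s2) && rect D).
Hypotheses (e1 : extendable k F1 rect) (e2 : extendable k F2 rect).

Let along (s : mono 2 4) l (f : mono l (2 + 1)) : C l := hK (monoM (mono_sum s (mono1 0)) f).

Let s_im (s : mono 2 4) (E : {set 'I_3}) : s @: E \subset mono_im s.
Proof. by apply/subsetP => _ /imsetP[x _ ->]; apply: mem_mono_im. Qed.

(** Extend a sphere first from the second span to [rect], then fill it using the
    first span, and restrict. *)
Lemma initial_cone_transfer :
  initial_cone span_flag (along s1) -> initial_cone span_flag (along s2).
Proof.
move=> ik n n0 h nh hk.
have dr : down rect by exact: down_flag.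
have dF (F : pred {set 'I_5}) (s : mono 2 4) :
    (forall D, F D = (D \subset mono_im s) && rect D) -> down F.
  move=> FE D E DE; rewrite !FE => /andP[/(subset_trans DE)-> /(dr _ _ DE)->//].
have dF1 := dF _ _ F1E; have dF2 := dF _ _ F2E.
have dp := @down_proper_faces n.
(* [G] is the vertex 0 of [Delta n]. Prescribing [hK] there makes the sphere extended to [rect]
   start at the cone [hK], as is needed to apply initiality under [s1]. *)
pose G (B : {set 'I_n.+1}) := B \subset [set ord0].
have dG : down G by move=> A B; apply: subset_trans.
have Gp B : G B -> proper_faces B.
  move=> GB; apply: contraTneq GB => ->; apply/subsetPn; exists ord_max; rewrite inE//.
  by rewrite -val_eqE /= -lt0n.
pose coll : mono (4 + n.+1) (4 + 1) := mono_sum (mono1 4) (mono_cst n ord0).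
have fam2 (F : pred {set 'I_5}) s r (Q : pred {set 'I_n.+1}) D :
    monoM r s = mono1 2 -> (forall E : {set 'I_3}, rect (s @: E) = span_flag E) ->
    (forall D, F D = (D \subset mono_im s) && rect D) ->
    fam F Q D -> fam span_flag Q (mono_sum r (mono1 n) @: D).
  move=> rs sF FE; rewrite fam_sum_im mono1_im /fam FE => /andP[/andP[Ds rD] ->].
  by rewrite -sF (imset_retrK rs Ds) rD.
have famS (s : mono 2 4) (Q : pred {set 'I_n.+1}) D :
    (forall E : {set 'I_3}, rect (s @: E) = span_flag E) -> fam span_flag Q D ->
    fam rect Q (mono_sum s (mono1 n) @: D).
  by move=> sF /andP[FD QD]; rewrite fam_sum_im mono1_im sF FD.
have nH1 : natural_on (fam F2 (@proper_faces n))
    (fun l f => h l (monoM (mono_sum r2 (mono1 n)) f)).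
  by apply: natural_on_comp nh => D; apply: fam2 s2K s2F F2E.
have nH2 : natural_on (fam rect G) (fun l f => hK (monoM coll f)).
  by apply: natural_on_comp nhK => D /andP[rD _]; rewrite fam_sum_im mono1_im rD.
have H12 : agree_on (predI (fam F2 (@proper_faces n)) (fam rect G))
    (fun l f => h l (monoM (mono_sum r2 (mono1 n)) f)) (fun l f => hK (monoM coll f)).
  move=> l f /andP[/= fF /andP[_ fG]].
  have lf : low (mono_im f) \subset mono_im s2.
    by case/andP: fF; rewrite F2E => /andP[].
  have cf : {in high (mono_im f), mono1 n =1 monoM (mono_cst 0 ord0) (mono_cst n ord0)}.
    by move=> i /(subsetP fG); rewrite inE => /eqP->.
  rewrite (sum_comp_high _ cf) -[r2]mono1M -mono_sumM monoA hk.
    by rewrite /along -monoA mono_sumM mono1M (sum_comp_low _ s2K lf).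
  by rewrite mono_imM fam_sum_im andbT -s2F imset_retrK//; case/andP: fF; rewrite F2E => /andP[].
have glue_inl l (a : mono l 4) : rect (mono_im a) ->
    fam rect G (mono_im (monoM (mono_inl 4 n) a)).
  by move=> ra; rewrite mono_imM /fam low_inl high_inl ra /G sub0set.
have coll_inl l (a : mono l 4) : rect (mono_im a) ->
    hK (monoM coll (monoM (mono_inl 4 n) a)) = k a.
  by move=> ra; rewrite -monoA mono_sum_comp_inl monoM1 kK.
have [||H' nH' H'E] := e2 dG dp _ Gp
    (glue_natural (down_fam dF2 dp) (down_fam dr dG) nH1 nH2 H12).
- by rewrite /G sub0set.
- by move=> l a ra; rewrite (glueR H12) ?coll_inl// glue_inl.
have H'2 l (f : mono l (4 + n.+1)) : fam rect G (mono_im f) -> H' l f = hK (monoM coll f).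
  by move=> fG; rewrite H'E ?(glueR H12)//= fG orbT.
have H'1 l (f : mono l (4 + n.+1)) : fam F2 (@proper_faces n) (mono_im f) ->
    H' l f = h l (monoM (mono_sum r2 (mono1 n)) f).
  by move=> fF; rewrite H'E ?glueL//= fF.
have [||h1 nh1 h1E] := ik n n0 (fun l f => H' l (monoM (mono_sum s1 (mono1 n)) f)).
- by apply: natural_on_comp nH' => D; apply: famS.
- move=> l f /andP[fF _]; rewrite -monoA mono_sumM monoM1 mono1M H'2.
    rewrite -monoA mono_sumM mono1M; congr (hK (monoM (mono_sum _ _) _)).
    by apply: mono_eq => i; rewrite (ord1 i); apply: val_inj.
  rewrite mono_imM fam_sum_im s1F fF /G; apply/subsetP => _ /imsetP[i _ ->].
  by rewrite inE.
have nh1' : natural_on (fam F1 predT) (fun l f => h1 l (monoM (mono_sum r1 (mono1 n)) f)).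
  by apply: natural_on_comp nh1 => D; apply: fam2 s1K s1F F1E.
have H3 : agree_on (predI (fam F1 predT) (fam rect (@proper_faces n)))
    (fun l f => h1 l (monoM (mono_sum r1 (mono1 n)) f)) H'.
  move=> l f /andP[/= /andP[fF _] /andP[_ fp]].
  have lf : low (mono_im f) \subset mono_im s1 by move: fF; rewrite F1E => /andP[].
  rewrite h1E.
    rewrite -monoA mono_sumM monoM1 (sum_comp_low _ s1K lf).
    by rewrite mono_sum1 mono1M.
  by rewrite mono_imM; apply: (fam2 _ _ _ _ _ s1K s1F F1E); rewrite /fam fF.
(* The filler exists under the first span; it is extended to [rect] with the sphere [H'] kept fixed
   on the boundary. *)
have [|||H4 nH4 H4E] := e1 dp (@down_predT _) _ _
    (glue_natural (down_fam dF1 (@down_predT _)) (down_fam dr dp) nh1' nH' H3) => //.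
- apply/negP => /eqP/setP/(_ ord0); by rewrite !inE.
- move=> l a ra; rewrite (glueR H3); first by rewrite H'2 ?coll_inl// glue_inl.
  have /andP[ra' /Gp pa] := glue_inl _ _ ra.
  by rewrite /fam ra' pa.
exists (fun l f => H4 l (monoM (mono_sum s2 (mono1 n)) f)).
  by apply: natural_on_comp nH4 => D; apply: famS.
move=> l f fF; have rf : fam rect (@proper_faces n) (mono_im (monoM (mono_sum s2 (mono1 n)) f)).
  by rewrite mono_imM; apply: famS.
rewrite H4E ?(glueR H3)//=; last by rewrite rf orbT.
rewrite H'1; first by rewrite -monoA mono_sumM s2K monoM1 mono_sum1 mono1M.
case/andP: rf; rewrite /fam => rl ->; rewrite F2E rl mono_imM low_sum s_im.
by [].
Qed.
End Transfer.

(** * Existence of pushouts *)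

Lemma nondegenerate_edge (K : sset) (e : K 1) l (a : mono l 1) : ~ degenerate (act e a) ->
  [\/ Tagged K (act e a) = Tagged K (act e (mono_cst 0 ord0)),
      Tagged K (act e a) = Tagged K (act e (mono_cst 0 ord_max)) |
      Tagged K (act e a) = Tagged K e].
Proof.
have ord2 (i : 'I_2) : i = ord0 \/ i = ord_max.
  by case: i => [[|[|?]] ?] //; [left|right]; apply: val_inj.
case: l a => [|[|l]] a nd.
- by case: (ord2 (a ord0)) => a0; [constructor 1|constructor 2];
    congr (Tagged _ (act e _)); apply: mono_eq => i; rewrite (ord1 i) a0.
- have deg j : a = mono_cst 1 j -> False.
    move=> aj; apply: nd; exists 0, (mono_cst 1 ord0), (act e (mono_cst 0 j)); split=> //.
    by rewrite actM aj; congr act; apply: mono_eq.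
  have aE i j : a ord0 = i -> a ord_max = j -> a =1 fun x => if x == ord0 then i else j.
    by move=> <- <- x; case: (ord2 x) => ->.
  have := mono_le a (leq0n _ : ((ord0 : 'I_2) <= (ord_max : 'I_2))%N).
  case: (ord2 (a ord0)) (ord2 (a ord_max)) => a0 [] a1; rewrite a0 a1 // => _.
  + by case: (@deg ord0); apply: mono_eq => x; rewrite (aE _ _ a0 a1); case: ifP.
  + constructor 3; rewrite (_ : a = mono1 1) ?act1//.
    by apply: mono_eq => x; rewrite (aE _ _ a0 a1); case: (ord2 x) => ->.
  + by case: (@deg ord_max); apply: mono_eq => x; rewrite (aE _ _ a0 a1); case: ifP.
- by case: nd; exists 1, a, e.
Qed.

Lemma finite_Span : finite_sset Span.
Proof.
pose e1 : Span 1 := exist _ _ (in_span_l (mono1 1)).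
pose e2 : Span 1 := exist _ _ (in_span_r (mono1 1)).
have e1P l (a : mono l 1) : exist _ _ (in_span_l a) = act e1 a :> Span l.
  by apply: eq_exist; congr pair; apply: mono_eq.
have e2P l (a : mono l 1) : exist _ _ (in_span_r a) = act e2 a :> Span l.
  by apply: eq_exist; congr pair; apply: mono_eq.
pose faces (e : Span 1) := classical_sets.setU
  (classical_sets.setU (classical_sets.set1 (Tagged Span (act e (mono_cst 0%N ord0))))
    (classical_sets.set1 (Tagged Span (act e (mono_cst 0%N ord_max)))))
  (classical_sets.set1 (Tagged Span e)).
apply: (@cardinality.sub_finite_set _ _ (classical_sets.setU (faces e1) (faces e2))).
  move=> [l x] /=; rewrite -[x]span_decodeK /span_decode.
  case: ifP => _; rewrite ?e1P ?e2P => /nondegenerate_edge[] e;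
    [right; left; left|right; left; right|right; right|
     left; left; left|left; left; right|left; right];
    exact: e.
by rewrite !cardinality.finite_setU; do !split; apply: cardinality.finite_set1.
Qed.

Section Existence.
Variable C : sset.

Lemma pushout_initial_cone (q : smap Square C) : pushout q ->
  exists k : forall l, mono l (2 + 1) -> C l,
    [/\ natural_on (fam span_flag predT) k, initial_cone span_flag k &
        forall a b, k 0 (square_code 0 (vertex a b)) = corner q a b].
Proof.
move=> qP; have dspan : down span_flag by exact: down_flag.
pose k l (f : mono l (2 + 1)) : C l :=
  unjoin span_decode (fun l (f : mono l 0) => act (square_cone q) f) f.
have nc : natural_on predT (fun l (f : mono l 0) => act (square_cone q) f).
  by move=> ? ? ? ? _; rewrite actM.
exists k; split=> [||a b].
- exact: (unjoin_natural dspan span_decode_natural (@down_predT _)).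
- apply: (initial_coneP dspan span_code_flag span_decode_natural) => //.
  + exact: span_codeK.
  + exact: span_decodeK.
  + exact: flag0.
have [ab|ab] := boolP ((a == ord_max) && (b == ord_max)).
  case/andP: ab => /eqP-> /eqP->; rewrite /k.
  have -> : square_code 0 (vertex ord_max ord_max) = monoM (mono_inr 2 0) (mono1 0).
    by apply: mono_eq => i; apply: val_inj; rewrite /= (ord1 i).
  by rewrite unjoin_inr act1.
have abP : in_span (vertex a b) by [].
by rewrite -(inl_span_code (exist _ _ abP)) /k unjoin_inl span_decodeK.
Qed.

Lemma span_initial_cone (p : smap Span C) : finite_colimits C ->
  exists k : forall l, mono l (2 + 1) -> C l,
    [/\ natural_on (fam span_flag predT) k, initial_cone span_flag k &
        forall l a, k l (monoM (mono_inl 2 0) a) = p l (span_decode a)].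
Proof.
move=> /(_ _ finite_Span p)[c cP]; have dspan : down span_flag by exact: down_flag.
have nc : natural_on predT (fun l (f : mono l 0) => act c f).
  by move=> ? ? ? ? _; rewrite actM.
exists (unjoin span_decode (fun l (f : mono l 0) => act c f)); split=> [||l a].
- exact: (unjoin_natural dspan span_decode_natural (@down_predT _)).
- apply: (initial_coneP dspan span_code_flag span_decode_natural) => //.
  + exact: span_codeK.
  + exact: span_decodeK.
  + exact: flag0.
exact: unjoin_inl.
Qed.

(** In the opposite, [o] is initial, so the sphere of dimension 1 made of the points [o] and [Z] has
    a filler there, which is an edge from [Z] to [o] in [C]. *)
Lemma terminal_edge (o Z : C 0) : terminal o ->
  exists e : C 1, act e (mono_cst 0 ord0) = Z /\ act e (mono_cst 0 ord_max) = o.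
Proof.
move=> oT.
pose b l (f : boundary 1 l) : op C l :=
  act (if sval f ord0 == ord0 then o else Z) (mono_cst l ord0).
have bn k l (f : boundary 1 l) (g : mono k l) : b k (act f g) = act (b l f) g.
  rewrite -[RHS]/(@act C _ _ (@act C _ _ _ _) (mono_rev g)) actM /b.
  congr (@act C _ _ _ _); last exact: mono_eq.
  case: f => f [j fj] /=; congr (if _ then _ else _).
  move: (fj (g ord0)) (fj ord0); clear fj; move: (f (g ord0)) (f ord0) j.
  by do 3![case=> [[|[|?]] ?] //].
have cst0 (X : C 0) : act X (mono_cst 0 ord0) = X.
  by rewrite -[RHS]act1; congr act; apply: mono_eq => i; rewrite (ord1 i).
have vertexP (j : 'I_2) : in_boundary (mono_cst 0 j : Delta 1 0).
  by exists (rev_ord j); case: j => [[|[|?]] ?].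
have [|e eP] := oT 1 isT (SMap bn).
  by move=> v /= v0; rewrite /b v0 eqxx cst0.
exists (e : C 1); split.
  have := eP 0 (exist _ _ (vertexP ord_max)); rewrite /= /b /=.
  rewrite [LHS](_ : _ = Z); last exact: cst0.
  by move=> ->; congr (@act C 0 1 e _); apply: mono_eq => i; apply: val_inj.
have := eP 0 (exist _ _ (vertexP ord0)); rewrite /= /b /=.
rewrite [LHS](_ : _ = o); last exact: cst0.
by move=> ->; congr (@act C 0 1 e _); apply: mono_eq => i; apply: val_inj.
Qed.
End Existence.

Lemma square_code_vertex (a b : 'I_2) (j : 'I_4) : (a + b.*2 = j)%N ->
  square_code 0 (vertex a b) = mono_cst 0 j.
Proof. by move=> abj; apply: mono_eq => i; apply: val_inj; exact: abj. Qed.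

Lemma natural_on_cst (C : sset) N (P : pred {set 'I_N.+1}) (h : forall l, mono l N -> C l) l j :
  natural_on P h -> P [set j] -> h l (mono_cst l j) = act (h 0 (mono_cst 0 j)) (mono_cst l ord0).
Proof.
move=> nh Pj; rewrite -nh ?mono_im_cst//; congr h; exact: mono_eq.
Qed.

Lemma monoM_cst m n l (f : mono m n) j : monoM f (mono_cst l j) = mono_cst l (f j).
Proof. exact: mono_eq. Qed.

(** * The composite of two pushout squares *)

Section Rect.
Variables (C : sset) (qC : quasicategory C).
Variables (k : forall l, mono l (2 + 1) -> C l) (nk : natural_on (fam span_flag predT) k).
Variables (e : C 1) (eZ : act e (mono_cst 0 ord0) = k (mono_cst 0 (v4 2))).

(** The square 0123 and the edge 2 -> 4 are glued at the vertex 2. This leaves only 024 and 04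
    missing from [rect], which is one inner horn. *)
Lemma rect_extension : exists h : forall l, mono l 4 -> C l,
  [/\ natural_on rect h,
      agree_on (fam span_flag predT) (fun l f => h l (monoM square_in_rect f)) k &
      h 0 (mono_cst 0 (v5 4)) = act e (mono_cst 0 ord_max)].
Proof.
pose t1 := [:: (v5 4, v5 4); (v5 1, v5 2)].
pose t2 := [:: (v5 0, v5 0); (v5 1, v5 1); (v5 3, v5 3)].
(* [t1] cuts out the square and [t2] the edge on 2 and 4, which [chi] matches with the ends of
   [e]. *)
pose chi : mono 4 1 := @mono_of_seq 4 1 [:: v2 0; v2 0; v2 0; v2 1; v2 1] isT.
pose h1 l (f : mono l 4) := k (monoM rect_to_square f).
pose h2 l (f : mono l 4) := act e (monoM chi f).
have flag1 (D : {set 'I_5}) : flag t1 D -> fam span_flag predT (rect_to_square @: D).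
  rewrite /t1 /flag /= => /and3P[n4 n12 _]; rewrite fam_span_flag.
  apply: contra n12 => /andP[/imsetP[i iD] i1 /imsetP[j jD] j2].
  have -> : v5 1 = i.
    by move: (congr1 val i1); case: (ord5 i) => [->|->|->|[->|->]] // _; apply: val_inj.
  have -> // : v5 2 = j; last by rewrite iD.
  by move: (congr1 val j2); case: (ord5 j) => [->|->|->|[->|->]] // _; apply: val_inj.
have n1 : natural_on (flag t1) h1 by exact: natural_on_comp nk.
have n2 : natural_on (flag t2) h2 by exact: natural_on_act.
have h12 : agree_on (predI (flag t1) (flag t2)) h1 h2.
  move=> l f; rewrite /flag /= => /andP[/and3P[]].
  rewrite !andbb => f4 _ _ /and4P[f0 f1 f3 _].
  have -> : f = mono_cst l (v5 2).
    apply: mono_im_singleton; apply/subsetP => i; rewrite inE.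
    case: (ord5 i) => [->|->|->|[->|->]] //;
      by rewrite ?(negPf f4) ?(negPf f0) ?(negPf f1) ?(negPf f3).
  rewrite /h1 /h2 !monoM_cst.
  have -> : rect_to_square (v5 2) = v4 2 by apply: val_inj.
  rewrite (natural_on_cst _ nk) -?eZ ?actM; first by congr act; apply: mono_eq => i; apply: val_inj.
  by rewrite fam_span_flag !inE.
have n12 := glue_natural (@down_flag _ _) (@down_flag _ _) n1 n2 h12.
pose c := predU (flag_code t1) (flag_code t2).
have cE D : coded c D = flag t1 D || flag t2 D by rewrite !flag_coded.
have {}n12 : natural_on (coded c) (glue (flag t1) h1 h2).
  by apply: natural_on_sub n12 => D; rewrite cE.
have dc : down (coded c).
  by move=> A B AB; rewrite !cE; apply: (down_or (@down_flag _ t1) (@down_flag _ t2) AB).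
have cell : cell_ok c ([:: true; false; true; false; true], 2) by [].
have [vA [u uA uv] addE FA] := cell_okP (isT : (2 < 5)%N) cell.
have [h nh hE] : exists2 h, natural_on rect h & agree_on (coded c) h (glue (flag t1) h1 h2).
  have -> : rect = coded (add_code c ([:: true; false; true; false; true], 2)).
    by rewrite /rect flag_coded; apply: eq_coded.
  rewrite -addE; apply: (extend_horn (u := u) (w := v5 4) qC dc n12 _ _ FA).
  - by split=> //; rewrite inE.
  - by rewrite uv.
  - by move=> D /or3P[->//|/eqP|/eqP]; [left|right].
exists h; split=> // [l f|].
  rewrite fam_span_flag => Ff.
  have sf : flag t1 (mono_im (monoM square_in_rect f)).
    rewrite mono_imM /flag /=.
    by have [_ -> -> [_ ->]] := mem_square_in_rect (mono_im f); rewrite Ff.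
  rewrite hE; last by rewrite cE sf.
  by rewrite glueL// /h1 -monoA square_in_rectK mono1M.
have f2 : flag t2 (mono_im (mono_cst 0 (v5 4))).
  by rewrite mono_im_cst /flag /= !inE.
rewrite hE; last by rewrite cE f2 orbT.
by rewrite (glueR h12)// /h2 monoM_cst; congr (act _ (mono_cst _ _)); apply: val_inj.
Qed.
End Rect.

Definition right_span : mono 2 4 := @mono_of_seq 2 4 [:: v5 2; v5 3; v5 4] isT.
Definition right_span_retr : mono 4 2 := @mono_of_seq 4 2 [:: v3 0; v3 0; v3 0; v3 1; v3 2] isT.
Definition long_span : mono 2 4 := @mono_of_seq 2 4 [:: v5 0; v5 1; v5 4] isT.
Definition long_span_retr : mono 4 2 := @mono_of_seq 4 2 [:: v3 0; v3 1; v3 1; v3 1; v3 2] isT.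

Lemma right_spanK : monoM right_span_retr right_span = mono1 2.
Proof. by apply: mono_eq => i; case: (ord3 i) => ->; apply: val_inj. Qed.

Lemma long_spanK : monoM long_span_retr long_span = mono1 2.
Proof. by apply: mono_eq => i; case: (ord3 i) => ->; apply: val_inj. Qed.

Lemma imset3 (s : mono 2 4) (E : {set 'I_3}) j :
  (j \in s @: E) = [|| (v3 0 \in E) && (s (v3 0) == j), (v3 1 \in E) && (s (v3 1) == j) |
    (v3 2 \in E) && (s (v3 2) == j)].
Proof.
apply/imsetP/idP => [[i iE ->]|].
  by case: (ord3 i) iE => -> ->; rewrite eqxx ?orbT.
by case/or3P => /andP[iE /eqP <-]; [exists (v3 0)|exists (v3 1)|exists (v3 2)].
Qed.

Lemma right_span_rect (E : {set 'I_3}) : rect (right_span @: E) = span_flag E.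
Proof.
rewrite rectE !imset3 -!val_eqE /= /span_flag /flag /=.
by rewrite !(andbF, andbT, orbF, orbT).
Qed.

Lemma long_span_rect (E : {set 'I_3}) : rect (long_span @: E) = span_flag E.
Proof.
rewrite rectE !imset3 -!val_eqE /= /span_flag /flag /=.
by rewrite !(andbF, andbT, orbF, orbT).
Qed.

Lemma sub_mono_im3 (s : mono 2 4) (D : {set 'I_5}) : (D \subset mono_im s) =
  [forall j : 'I_5, (j \in D) ==> [|| s (v3 0) == j, s (v3 1) == j | s (v3 2) == j]].
Proof.
have sE j : (j \in mono_im s) = [|| s (v3 0) == j, s (v3 1) == j | s (v3 2) == j].
  apply/mono_imP/or3P => [[i <-]|].
    by case: (ord3 i) => ->; [constructor 1|constructor 2|constructor 3]; rewrite eqxx.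
  by case=> /eqP <-; [exists (v3 0)|exists (v3 1)|exists (v3 2)].
apply/subsetP/forallP => [Ds j|Ds j jD].
  by apply/implyP => /Ds; rewrite sE.
by rewrite sE; apply: (implyP (Ds j)).
Qed.

Lemma right_spanE (D : {set 'I_5}) : rect_span D = (D \subset mono_im right_span) && rect D.
Proof.
rewrite sub_mono_im3 /rect_span /rect /flag /=; apply/idP/idP => [/and4P[]|].
  rewrite !andbb => n0 n1 n34 _; rewrite (negPf n1) n34 !andbT; apply/forallP => j.
  by case: (ord5 j) => [->|->|->|[->|->]]; rewrite ?(negPf n0) ?(negPf n1) ?implybT.
case/andP => /forallP Dj /and4P[_ _ -> _]; rewrite !andbb andbT.
by apply/andP; split; apply/negP => /(implyP (Dj _)).
Qed.

Lemma long_spanE (D : {set 'I_5}) : outer_span D = (D \subset mono_im long_span) && rect D.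
Proof.
rewrite sub_mono_im3 /outer_span /rect /flag /=; apply/idP/idP => [/and4P[]|].
  rewrite !andbb => n2 n3 n14 _; rewrite (negPf n2) (negPf n3) andbF n14 !andbT.
  apply/forallP => j.
  by case: (ord5 j) => [->|->|->|[->|->]]; rewrite ?(negPf n2) ?(negPf n3) ?implybT.
case/andP => /forallP Dj /and4P[_ -> _ _]; rewrite !andbb andbT.
by apply/andP; split; apply/negP => /(implyP (Dj _)).
Qed.

Lemma inl_lretr_mono m n l (f : mono l (m + n.+1)) : high (mono_im f) = set0 ->
  f = monoM (mono_inl m n) (monoM (lretr m n) f).
Proof.
move=> f0; apply: mono_eq => i; rewrite !monoMx.
have [[a ->]|[b fi]] := join_ordP (f i); first by rewrite lretr_inl.
have : b \in high (mono_im f) by rewrite inE -fi mem_mono_im.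
by rewrite f0 inE.
Qed.

(** Push the edge (0, 1) -> (1, 1) out along (0, 1) -> [o]; the composite of both
    squares is again a pushout. *)
Lemma exact_triangle_paste (C : sset) (q : smap Square C) (o : C 0) :
  quasicategory C -> finite_colimits C -> terminal o -> pushout q ->
  exists Q, exact_triangle o (corner q ord0 ord_max) (corner q ord_max ord_max) Q /\
            exact_triangle o (corner q ord0 ord0) (corner q ord_max ord0) Q.
Proof.
move=> qC fC oT /pushout_initial_cone[k1 [nk1 ik1 k1q]].
have [e [eZ eo]] := terminal_edge (k1 0 (mono_cst 0 (v4 2))) oT.
have [k [nk kk1 ko]] := rect_extension qC nk1 eZ.
rewrite eo in ko.
have dr : down rect by exact: down_flag.
have e_right : extendable k rect_span rect by exact: extendable_rect_span.
have e_long : extendable k outer_span rect.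
  apply: (@extendable_trans _ _ _ _ rect_no3); try exact: down_flag.
  - by rewrite /outer_span /rect_no3 /flag /= => D; case: (v5 2 \in D); rewrite ?andbF.
  - by rewrite /rect_no3 /rect /flag /= => D; case: (v5 3 \in D); rewrite ?andbF.
  - exact: extendable_outer_span.
  (* This is where the universal property of [q] enters. *)
  - apply: extendable_rect_no3; apply: initial_cone_agree ik1 => l f Ff.
    by rewrite kk1.
have p_act l' l (x : Span l) (f : mono l' l) :
    k l' (monoM right_span (span_code l' (act x f))) =
    act (k l (monoM right_span (span_code l x))) f.
  rewrite smap_act -[act (span_code l x) f]/(monoM _ f) -monoA nk//.
  by rewrite mono_imM right_span_rect span_code_flag.
have [kQ [nkQ ikQ kQE]] := span_initial_cone
  (@SMap Span C (fun l x => k l (monoM right_span (span_code l x))) p_act) fC.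
have kQ_inl l (a : mono l 2) : span_flag (mono_im a) ->
    kQ l (monoM (mono_inl 2 0) a) = k l (monoM right_span a).
  move=> Fa; rewrite kQE.
  by rewrite -[LHS]/(k l (monoM right_span (span_code l (span_decode a)))) span_codeK.
have d_right : down rect_span by exact: down_flag.
(* A lifting problem over [Delta 0], with [G0] its empty subcomplex: the cone [kQ] under the second
   span extends to a cone [hK] with the same apex under all of [rect]. *)
pose G0 : pred {set 'I_1} := fun B => B == set0.
have dG0 : down G0 by move=> A B; rewrite /G0 => AB /eqP B0; rewrite -subset0 -B0.
have n1 : natural_on (fam rect_span predT)
    (fun l f => kQ l (monoM (mono_sum right_span_retr (mono1 0)) f)).
  apply: natural_on_comp nkQ => D /andP[lD _]; rewrite fam_sum_im andbT.
  move: lD; rewrite right_spanE => /andP[Ds]; rewrite -right_span_rect.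
  by rewrite (@imset_retrK _ _ _ _ _ right_spanK Ds).
have n2 : natural_on (fam rect G0) (fun l f => k l (monoM (lretr 4 0) f)).
  apply: natural_on_comp nk => D /andP[rD /eqP D0].
  have -> // : lretr 4 0 @: D = low D.
  rewrite -[D]joinK D0 /join imset0 setU0 low_inl -imset_comp -[RHS]imset_id.
  by apply: eq_imset => a; apply: lretr_inl.
have n12 : agree_on (predI (fam rect_span predT) (fam rect G0))
    (fun l f => kQ l (monoM (mono_sum right_span_retr (mono1 0)) f))
    (fun l f => k l (monoM (lretr 4 0) f)).
  move=> l f /andP[/= /andP[sf _] /andP[rf /eqP f0]].
  rewrite {1}(inl_lretr_mono f0) -monoA mono_sum_comp_inl monoA.
  have lf : mono_im (monoM (lretr 4 0) f) = low (mono_im f).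
    by rewrite [in RHS](inl_lretr_mono f0) [in RHS]mono_imM low_inl.
  move: sf rf; rewrite -lf => sf rf.
  have sub : mono_im (monoM (lretr 4 0) f) \subset mono_im right_span.
    by move: sf; rewrite right_spanE => /andP[].
  rewrite kQ_inl; first by rewrite (mono_imK right_spanK sub).
  by rewrite mono_imM -right_span_rect (@imset_retrK _ _ _ _ _ right_spanK sub).
have G0f l (a : mono l 4) : rect (mono_im a) ->
    fam rect G0 (mono_im (monoM (mono_inl 4 0) a)).
  by move=> ra; rewrite /fam mono_imM low_inl high_inl ra /G0 eqxx.
have [|||hK nhK hKE] := e_right 0 G0 predT dG0 (@down_predT _) _ _ _
  (glue_natural (down_fam d_right (@down_predT _)) (down_fam dr dG0) n1 n2 n12) => //.
- by rewrite /G0 eqxx.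
- move=> l a ra; rewrite (glueR n12) ?G0f//; congr k.
  by apply: mono_eq => i; rewrite !monoMx lretr_inl.
have hK_right l (f : mono l (2 + 1)) : fam span_flag predT (mono_im f) ->
    hK l (monoM (mono_sum right_span (mono1 0)) f) = kQ l f.
  move=> Ff; have sf : fam rect_span predT (mono_im (monoM (mono_sum right_span (mono1 0)) f)).
    rewrite mono_imM fam_sum_im right_spanE right_span_rect.
    case/andP: Ff => -> _; rewrite !andbT.
    by apply/subsetP => _ /imsetP[i _ ->]; apply: mem_mono_im.
  rewrite hKE; last by rewrite /= sf.
  by rewrite glueL// -monoA mono_sumM right_spanK mono1M mono_sum1 mono1M.
have hK_inl l (a : mono l 4) : rect (mono_im a) ->
    hK l (monoM (mono_inl 4 0) a) = k l a.
  move=> ra; rewrite hKE; last by rewrite /= G0f ?orbT.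
  rewrite (glueR n12) ?G0f//; congr k.
  by apply: mono_eq => i; rewrite !monoMx lretr_inl.
pose k2 l (f : mono l (2 + 1)) := hK l (monoM (mono_sum long_span (mono1 0)) f).
have nk2 : natural_on (fam span_flag predT) k2.
  apply: natural_on_comp nhK => D /andP[FD _].
  by rewrite fam_sum_im long_span_rect FD.
(* [hK] restricts to [kQ] under one span and to [k2] under the other, so initiality passes from the
   second square to the composite. *)
have ik2 : initial_cone span_flag k2.
  apply: (initial_cone_transfer nhK hK_inl right_spanK long_spanK right_span_rect
    long_span_rect right_spanE long_spanE e_right e_long).
  by apply: initial_cone_agree ikQ => l f /hK_right.
have k_square j : k 0 (mono_cst 0 (square_in_rect j)) = k1 0 (mono_cst 0 j).
  rewrite -kk1 ?monoM_cst// mono_im_cst fam_span_flag !inE.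
  by case: (ord4 j) => ->.
have rect1 j : rect (mono_im (mono_cst 0 j)).
  by rewrite mono_im_cst /rect /flag /= !inE; case: (ord5 j) => [->|->|->|[->|->]].
have kQ_vertex (i : 'I_3) (j : 'I_4) (v : 'I_5) : val i = val j -> right_span i = v ->
    kQ 0 (mono_cst 0 j) = k 0 (mono_cst 0 v).
  move=> ij <-; rewrite -monoM_cst -kQ_inl; first by congr kQ; apply: mono_eq => x; apply: val_inj.
  by rewrite -right_span_rect -mono_imM monoM_cst rect1.
have k2_vertex (i : 'I_3) (j : 'I_4) (v : 'I_5) : val i = val j -> long_span i = v ->
    k2 0 (mono_cst 0 j) = k 0 (mono_cst 0 v).
  move=> ij <-; rewrite -(hK_inl _ _ (rect1 _)) /k2; congr hK.
  have -> : mono_cst 0 j = monoM (mono_inl 2 0) (mono_cst 0 i).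
    by apply: mono_eq => x; apply: val_inj.
  by rewrite -monoA mono_sum_comp_inl monoA monoM_cst.
have k2_apex : k2 0 (mono_cst 0 (v4 3)) = kQ 0 (mono_cst 0 (v4 3)).
  have e3 : mono_cst 0 (v4 3) = monoM (mono_inr 2 0) (mono1 0).
    by apply: mono_eq => x; apply: val_inj; rewrite /= (ord1 x).
  rewrite -hK_right.
    by rewrite /k2 e3 -!monoA !mono_sum_comp_inr.
  by rewrite mono_im_cst fam_span_flag !inE.
have corners (a b : 'I_2) (j : 'I_4) : (a + b.*2 = j)%N -> corner q a b = k1 0 (mono_cst 0 j).
  by move=> abj; rewrite -k1q (square_code_vertex abj).
exists (kQ 0 (mono_cst 0 (v4 3))); split.
  exists (square_of nkQ); first exact: initial_cone_pushout.
  split.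
  - rewrite (@corner_square_of _ _ _ _ _ (v4 0))// (@corners _ _ (v4 2))// -k_square.
    by apply: (kQ_vertex (v3 0)) => //; apply: val_inj.
  - rewrite (@corner_square_of _ _ _ _ _ (v4 1))// (@corners _ _ (v4 3))// -k_square.
    by apply: (kQ_vertex (v3 1)) => //; apply: val_inj.
  - rewrite (@corner_square_of _ _ _ _ _ (v4 2))// -ko.
    by apply: (kQ_vertex (v3 2)) => //; apply: val_inj.
  - by rewrite (@corner_square_of _ _ _ _ _ (v4 3)).
exists (square_of nk2); first exact: initial_cone_pushout.
split.
- rewrite (@corner_square_of _ _ _ _ _ (v4 0))// (@corners _ _ (v4 0))// -k_square.
  by apply: (k2_vertex (v3 0)) => //; apply: val_inj.
- rewrite (@corner_square_of _ _ _ _ _ (v4 1))// (@corners _ _ (v4 1))// -k_square.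
  by apply: (k2_vertex (v3 1)) => //; apply: val_inj.
- rewrite (@corner_square_of _ _ _ _ _ (v4 2))// -ko.
  by apply: (k2_vertex (v3 2)) => //; apply: val_inj.
- by rewrite (@corner_square_of _ _ _ _ _ (v4 3)).
Qed.

Local Open Scope ring_scope.

(** * The Grothendieck heap and group *)

Lemma freeg_ind (K : choiceType) (S : {pred {freeg K / int}}) :
  zmod_closed S -> (forall z, << z >> \in S) -> forall D, D \in S.
Proof.
move=> SC Sgen D; pose SZ := GRing.isZmodClosed.Build _ S SC.
pose T : zmodClosed {freeg K / int} := HB.pack_for (zmodClosed {freeg K / int}) S SZ.
rewrite -(freeg_sumE D); change (\sum_(z <- dom D) << coeff z D *g z >> \in T).
apply: rpred_sum => z _; rewrite -[coeff z D]intz -freegU_mulz.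
exact/rpredMz/Sgen.
Qed.

Lemma morphB_D (U V : zmodType) (f : U -> V) :
  {morph f : x y / x - y} -> {morph f : x y / x + y}.
Proof.
move=> fB x y; have f0 : f 0 = 0 by rewrite -(subrr 0) fB subrr.
by rewrite -[y in LHS]opprK -[- y]sub0r !fB f0 sub0r opprK.
Qed.

Lemma morph_additive (U V : zmodType) (f : U -> V) : {morph f : x y / x + y} ->
  exists g : {additive U -> V}, g =1 f.
Proof.
move=> fD; have f0 : f 0 = 0 by apply: (addrI (f 0)); rewrite -fD !addr0.
have fB : zmod_morphism f.
  by move=> x y; apply: (addIr (f y)); rewrite -fD !subrK.
by exists (HB.pack_for {additive U -> V} f (GRing.isZmodMorphism.Build U V f fB)).
Qed.

Lemma zmod_projD (V : zmodType) A (x y : V) :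
  zmod_proj A (x + y) = zmod_proj A x + zmod_proj A y.
Proof. by rewrite /zmod_proj !piE. Qed.

Lemma zmod_projN (V : zmodType) A (x : V) : zmod_proj A (- x) = - zmod_proj A x.
Proof. by rewrite /zmod_proj !piE. Qed.

Lemma zmod_proj_eq (V : zmodType) A (x y : V) :
  zmod_proj A x = zmod_proj A y <-> subgroup_gen A (x - y).
Proof.
rewrite -[subgroup_gen A _]/(_ \in subgroup_gen_zmodClosed A) -Quotient.equivE.
by split=> [/eqquotP|?]; last apply/eqquotP.
Qed.

Lemma zmod_projW (V : zmodType) A (P : zmod_quot A -> Prop) :
  (forall x : V, P (zmod_proj A x)) -> forall a, P a.
Proof. by move=> Px; elim/quotW. Qed.

(** In every retract the heap operation is that of the group, whatever the base point; heap
    relations thus become identities between differences. *)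
Lemma retract_hop (H : abHeapType) (e : H) (a b c : retract e) :
  (a - b + c : retract e) = hop (a : H) b c.
Proof.
by rewrite !retractE -[(- b : retract e)]/(hop e b e : H) hop_assoc hop_idr -hop_assoc hop_idl.
Qed.

(** * The mutually inverse maps *)

Section Comparison.
Variables (C : sset) (o : C 0%N).
Hypotheses (qC : quasicategory C) (fC : finite_colimits C) (oT : terminal o).
Hypothesis pushP : forall q : smap Square C, pushout q <-> pullback q.

Definition class_gen (A : object_class C) : K0c o := zmod_proj (K0c_rel o) << A >>.

Lemma class_exact (X Y Z : C 0%N) : exact_triangle o X Y Z ->
  K0c_class o X + K0c_class o Z = K0c_class o Y.
Proof.
move=> XYZ; rewrite -zmod_projD; apply/zmod_proj_eq/asboolP => S _; apply.
by exists X, Y, Z.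
Qed.

Lemma class_pushout (q : smap Square C) : pushout q ->
  K0c_class o (corner q ord_max ord0) + K0c_class o (corner q ord0 ord_max) =
  K0c_class o (corner q ord0 ord0) + K0c_class o (corner q ord_max ord_max).
Proof.
move=> /(exact_triangle_paste qC fC oT)[Q [/class_exact <- /class_exact <-]].
by rewrite -addrA; congr (_ + _); rewrite addrC.
Qed.

(** Compare the two relations given by the square underlying an exact triangle. *)
Lemma class_zero : K0c_class o o = 0.
Proof.
have [k [nk ik _]] : exists k : forall l, mono l (2 + 1) -> C l,
    [/\ natural_on (fam span_flag predT) k, initial_cone span_flag k & True].
  (* Some exact triangle on [o] is needed; pasting onto the pushout of the constant span at [o]
     provides one. *)
  have pn l' l (x : Span l) (f : mono l' l) :
      act o (mono_cst l' ord0) = act (act o (mono_cst l ord0)) f.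
    by rewrite actM; congr act; apply: mono_eq.
  have [k [nk ik _]] := span_initial_cone
    (@SMap Span C (fun l _ => act o (mono_cst l ord0)) pn) fC.
  by exists k.
have [Q [t _]] := exact_triangle_paste qC fC oT (initial_cone_pushout (nk := nk) ik).
have := class_exact t; case: t => q qP [q00 q10 q01 q11].
have := class_pushout qP; rewrite q01 q10 q00 q11 => <-.
by rewrite -[RHS]addr0 => /addrI.
Qed.

Fixpoint word_class (w : heap_word (object_class C)) : K0c o :=
  match w with
  | hw_gen A => class_gen A
  | hw_op u v w => word_class u - word_class v + word_class w
  end.

Lemma word_class_eq u v : heap_eq u v -> word_class u = word_class v.
Proof.
elim=> //= {u v} [u v w _ -> _ ->//|u u' v v' w w' _ -> _ -> _ ->//|u v|u v|u v u' v' w'|u v w].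
- by rewrite subrr add0r.
- by rewrite subrK.
- by rewrite !addrA.
- by rewrite addrAC [RHS]addrAC [X in X - _]addrC.
Qed.

Definition free_class (x : free_heap (object_class C)) : K0c o := word_class (repr x).

Lemma free_class_pi w : free_class (\pi_(free_heap (object_class C))%qT w) = word_class w.
Proof. by apply/word_class_eq/free_heap_eqP; rewrite reprK. Qed.

Lemma free_class_hop x y z :
  free_class (hop x y z) = free_class x - free_class y + free_class z.
Proof.
elim/quotW: x => x; elim/quotW: y => y; elim/quotW: z => z.
by rewrite free_heap_hopE !free_class_pi.
Qed.

Lemma free_class_gen X : free_class (heap_gen (object_class_of X)) = K0c_class o X.
Proof. exact: free_class_pi. Qed.

Lemma free_class_cong x y : heap_cong (@K0_rel C) x y -> free_class x = free_class y.
Proof.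
elim=> {x y} [x y [q [qP _] [-> ->]]|//|x y _ ->//|x y z _ -> _ ->//|]; last first.
  by move=> x x' y y' z z' _ ex _ ey _ ez; rewrite !free_class_hop ex ey ez.
rewrite free_class_hop !free_class_gen addrAC class_pushout//.
by rewrite addrAC subrr add0r.
Qed.

Definition K0_to_K0c (x : K0 C) : K0c o := free_class (repr x).

Lemma K0_to_K0c_proj x : K0_to_K0c (heap_proj (@K0_rel C) x) = free_class x.
Proof. by apply/free_class_cong/heap_quot_eqP; rewrite /heap_proj reprK. Qed.

Lemma K0_to_K0c_hop x y z :
  K0_to_K0c (hop x y z) = K0_to_K0c x - K0_to_K0c y + K0_to_K0c z.
Proof.
elim/heap_projW: x => x; elim/heap_projW: y => y; elim/heap_projW: z => z.
by rewrite heap_projE !K0_to_K0c_proj free_class_hop.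
Qed.

Lemma K0_to_K0c_class X : K0_to_K0c (K0_class X) = K0c_class o X.
Proof. by rewrite K0_to_K0c_proj free_class_gen. Qed.

Local Notation H := (retract (K0_class o)).

Definition heap_class_gen (A : object_class C) : H := heap_proj (@K0_rel C) (heap_gen A).

(** [fglift] takes values in a module, so the retract is viewed as a module over the integers
    through [zmodule]. *)
Definition free_heap_class (x : {freeg (object_class C) / int}) : H :=
  fglift (fun A => heap_class_gen A : zmodule H) x.

Lemma free_heap_classB : {morph free_heap_class : x y / x - y}.
Proof. by move=> x y; apply: (@lift_is_additive int _ (zmodule H)). Qed.

Lemma free_heap_class_gen A : free_heap_class << A >> = heap_class_gen A.
Proof. by rewrite /free_heap_class liftU scale1r. Qed.

Lemma free_heap_class_rel x : subgroup_gen (K0c_rel o) x -> free_heap_class x = 0.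
Proof.
(* The generated subgroup lies in every subgroup containing the relations, here in the kernel. *)
move=> /asboolP xS; apply/eqP; apply: (xS (fun x => free_heap_class x == 0)).
  split=> [|y z /eqP y0 /eqP z0]; apply/eqP; last by rewrite free_heap_classB y0 z0 subr0.
  by rewrite -(subrr 0) free_heap_classB subrr.
move=> _ [_ [_ [_ [[q qP [<- <- q01 <-]] ->]]]].
apply/eqP; rewrite free_heap_classB (morphB_D free_heap_classB) !free_heap_class_gen.
have -> : heap_class_gen (object_class_of (corner q ord_max ord_max)) =
    heap_class_gen (object_class_of (corner q ord_max ord0)) -
    heap_class_gen (object_class_of (corner q ord0 ord0)) +
    heap_class_gen (object_class_of (corner q ord0 ord_max)).
  rewrite retract_hop heap_projE; apply/esym/heap_quot_eqP/heap_cong_rel.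
  (* The square of an exact triangle is given as a pushout; [pushP] makes it bicartesian, hence a
     relation of the heap. *)
  by exists q => //; split=> //; apply/pushP.
have -> : heap_class_gen (object_class_of (corner q ord0 ord_max)) = 0 by rewrite q01.
by rewrite addr0 addrCA subrr addr0 subrr.
Qed.

Definition K0c_to_K0 (a : K0c o) : H := free_heap_class (repr a).

Lemma K0c_to_K0_proj x : K0c_to_K0 (zmod_proj (K0c_rel o) x) = free_heap_class x.
Proof.
apply/eqP; rewrite -subr_eq0 -free_heap_classB; apply/eqP/free_heap_class_rel/zmod_proj_eq.
by rewrite /zmod_proj reprK.
Qed.

Lemma K0c_to_K0B : {morph K0c_to_K0 : a b / a - b}.
Proof.
elim/zmod_projW => x; elim/zmod_projW => y.
by rewrite -zmod_projN -zmod_projD !K0c_to_K0_proj free_heap_classB.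
Qed.

(** A heap map sends [x, o, y] to x - o + y, so additivity amounts to the vanishing of the class of
    [o]. *)
Lemma K0_to_K0cD : {morph (K0_to_K0c : H -> K0c o) : x y / x + y}.
Proof. by move=> x y; rewrite retractE K0_to_K0c_hop K0_to_K0c_class class_zero subr0. Qed.

(** The composite preserves the heap operation and fixes the generators, and every element is the
    class of a word in them. *)
Lemma K0_to_K0cK : cancel (K0_to_K0c : H -> K0c o) K0c_to_K0.
Proof.
elim/heap_projW => x; elim/quotW: x => w; rewrite K0_to_K0c_proj free_class_pi.
elim: w => [A|u IHu v IHv w IHw] /=.
  by rewrite K0c_to_K0_proj free_heap_class_gen.
by rewrite (morphB_D K0c_to_K0B) K0c_to_K0B IHu IHv IHw retract_hop heap_projE free_heap_hopE.
Qed.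

Lemma K0c_to_K0K : cancel K0c_to_K0 (K0_to_K0c : H -> K0c o).
Proof.
have [f fE] := morph_additive K0_to_K0cD.
elim/zmod_projW => x; rewrite K0c_to_K0_proj -fE; apply/eqP.
apply: (freeg_ind (S := fun x => f (free_heap_class x) == zmod_proj (K0c_rel o) x)).
  split=> [|y z /eqP ey /eqP ez]; apply/eqP.
    have -> : free_heap_class 0 = 0 by rewrite -(subrr 0) free_heap_classB subrr.
    by rewrite raddf0 -[in RHS](subrr 0) zmod_projD zmod_projN subrr.
  by rewrite free_heap_classB raddfB ey ez zmod_projD zmod_projN.
move=> A; apply/eqP; rewrite free_heap_class_gen fE.
by rewrite K0_to_K0c_proj free_class_pi.
Qed.
End Comparison.

Theorem theorem2p10 (C : sset) (hC : stable C) (o : C 0%N)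
    (ho : zero_object o) :
  exists phi : {additive retract (K0_class o) -> K0c o},
    bijective phi /\ forall X : C 0%N, phi (K0_class X) = K0c_class o X.
Proof.
have [[[qC _ fC pushP] _] [_ oT]] := (hC, ho).
have [phi phiE] := morph_additive (K0_to_K0cD qC fC oT).
exists phi; split=> [|X]; last by rewrite phiE K0_to_K0c_class.
exists (@K0c_to_K0 C o) => a; first by rewrite phiE K0_to_K0cK.
by rewrite phiE K0c_to_K0K.
Qed.
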